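(* Let $\mathbf f$ be a quadratic, clean and feasible monotone system of polynomials, and let $\boldsymbol\nu^{(j)}$ denote the result of $\mathrm{DNM}(\mathbf f,j)$. Then there is $k_{\mathbf f}\in\mathbb N$ such that for every $i\ge0$, $\boldsymbol\nu^{(k_{\mathbf f}+i)}$ has at least $i$ valid bits of $\mu\mathbf f$.
   Context: A monotone system of polynomials (MSP) $\mathbf f$ has components that are polynomials with nonnegative coefficients in $X_1,\dots,X_n$; clean and feasible means every variable is positive in some Kleene iterate $\mathbf f^k(\mathbf 0)$ and $\mathbf f$ has a nonnegative fixed point, whose least one is $\mu\mathbf f$; quadratic means all monomials have degree $\le2$. $X_i$ depends directly on $X_k$ if $\partial f_i/\partial X_k\not\equiv0$; strongly connected components (SCCs) are maximal sets of mutually dependent variables, forming a DAG with edge $S'\to S$ if a variable of $S$ depends directly on one of $S'\ne S$. A top SCC is one on which no other depends; the depth of $S$ is the length of the longest path from $S$ to a top SCC; $h(\mathbf f)$ is the maximal depth and $\mathrm{comp}(t)$ the set of SCCs of depth $t$. For an SCC $S$, $\mathbf f_S$ is the subsystem of equations of variables in $S$. Newton operator: $\mathcal N_{\mathbf g}(\mathbf X)=\mathbf X+(\mathrm{Id}-\mathbf g'(\mathbf X))^{-1}(\mathbf g(\mathbf X)-\mathbf X)$. $\mathrm{DNM}(\mathbf f,j)$: for $t$ from $h(\mathbf f)$ down to $0$, for each $S\in\mathrm{comp}(t)$, set $\boldsymbol\nu_S:=\mathcal N_{\mathbf f_S}^{\,j\cdot2^t}(\mathbf 0)$ and substitute $\boldsymbol\nu_S$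 for $\mathbf X_S$ in all equations of SCCs of smaller depth; return $\boldsymbol\nu$. A vector $\boldsymbol\nu$ has $i$ valid bits of $\mu\mathbf f$ if $|(\mu\mathbf f)_j-\nu_j|/|(\mu\mathbf f)_j|\le2^{-i}$ for all $j$. *)

(* Defs.v *)
From mathcomp Require Import all_boot all_order all_algebra.
From mathcomp Require Import classical_sets reals.
From mathcomp Require Import mpoly.

Set Implicit Arguments.
Unset Strict Implicit.
Unset Printing Implicit Defensive.

Import Order.TTheory GRing.Theory Num.Theory.
Local Open Scope ring_scope.

Section Systems.
Context {R : realType}.

Definition psys (n : nat) := 'I_n -> {mpoly R[n]}.

Section OneSystem.
Context {n : nat}.
Implicit Types (f : psys n) (X Y : 'cV[R]_n) (S T : {set 'I_n}).

Definition monotone f := forall i (m : 'X_{1..n}), 0 <= (f i)@_m.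

(* msize is the total degree plus one. *)
Definition quadratic f := forall i, (msize (f i) <= 3)%N.

Definition eval_sys f X : 'cV[R]_n := \col_i (f i).@[fun k => X k 0].

Definition kleene f (k : nat) : 'cV[R]_n := iter k (eval_sys f) 0.

Definition nneg_fixpoint f X := (forall k, 0 <= X k 0) /\ eval_sys f X = X.

Definition feasible f := exists X, nneg_fixpoint f X.

Definition clean f := forall i, exists k : nat, 0 < kleene f k i 0.

Definition is_lfp f X :=
  nneg_fixpoint f X /\ forall Y, nneg_fixpoint f Y -> forall k, X k 0 <= Y k 0.

(* The value 0 is a default, used only if there is no least fixed point. *)
Definition lfp f : 'cV[R]_n := xget 0 (is_lfp f).

Definition jacobian f X : 'M[R]_n :=
  \matrix_(i, k) (mderiv k (f i)).@[fun l => X l 0].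

(* invmx A = A when A is singular. *)
Definition newton f X : 'cV[R]_n :=
  X + invmx (1%:M - jacobian f X) *m (eval_sys f X - X).

Definition ddepends f : rel 'I_n := fun i k => mderiv k (f i) != 0.

(* connect is reflexive: a variable that is on no cycle forms an SCC alone. *)
Definition sccs f : {set {set 'I_n}} :=
  [set S | maxset (fun T : {set 'I_n} =>
     [forall i in T, forall k in T, connect (ddepends f) i k]) S].

Definition scc_edge f : rel {set 'I_n} := fun S' S =>
  [&& S' \in sccs f, S \in sccs f, S' != S &
      [exists i in S, exists k in S', ddepends f i k]].

Definition top_scc f S := (S \in sccs f) && [forall T, ~~ scc_edge f S T].

(* Paths in the acyclic graph of SCCs have fewer than n edges when n > 0,
   so the bound on the length m is no restriction. *)
Definition depth f S : nat :=
  \max_(m < n.+1 | [exists p : m.-tuple {set 'I_n},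
                     path (scc_edge f) S p && top_scc f (last S p)]) m.

Definition height f : nat := \max_(S in sccs f) depth f S.

Definition sccs_at f (t : nat) : {set {set 'I_n}} :=
  [set S in sccs f | depth f S == t].

(* Extends a vector indexed by S to all of 'I_n, with value 0 outside S. *)
Definition extend {V : nmodType} S (x : 'I_#|S| -> V) (k : 'I_n) : V :=
  \sum_(a | enum_val a == k) x a.

Definition subst f S (x : 'cV[R]_#|S|) (i : 'I_n) : {mpoly R[n]} :=
  f i \mPo [tuple (if k \in S then mpolyC n (extend (fun a => x a 0) k)
                   else 'X_k) | k < n].

End OneSystem.

(* The equations of S as a system in the #|S| variables of S. It is used when
   these equations contain no variable outside S, so that sending such
   variables to 0 has no effect. *)
Definition subsys {n} (f : psys n) (S : {set 'I_n}) : psys #|S| := fun a =>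
  f (enum_val a) \mPo
    [tuple extend (fun b : 'I_#|S| => 'X_b : {mpoly R[#|S|]}) k | k < n].

Arguments subsys {n} f S _.

(* A state is the current system, after the substitutions made so far, and the
   values computed so far. SCCs and depths are those of the input system f. *)
Definition dnm_scc {n} (f : psys n) (j t : nat)
    (st : psys n * 'cV[R]_n) (S : {set 'I_n}) : psys n * 'cV[R]_n :=
  let: (g, nu) := st in
  let nuS : 'cV[R]_#|S| := iter (j * 2 ^ t) (newton (subsys g S)) 0 in
  (fun i => if [exists T in sccs f, (i \in T) && (depth f T < t)%N]
            then subst g nuS i else g i,
   \col_k (if k \in S then extend (fun a => nuS a 0) k else nu k 0)).

Definition dnm_level {n} (f : psys n) (j : nat)
    (st : psys n * 'cV[R]_n) (t : nat) : psys n * 'cV[R]_n :=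
  foldl (dnm_scc f j t) st (enum (sccs_at f t)).

Definition dnm {n} (f : psys n) (j : nat) : 'cV[R]_n :=
  (foldl (dnm_level f j) (f, 0) (rev (iota 0 (height f).+1))).2.

Definition valid_bits {n} (i : nat) (mu nu : 'cV[R]_n) :=
  forall k, `|mu k 0 - nu k 0| / `|mu k 0| <= 2 ^- i.

End Systems.

Arguments psys : clear implicits.

(* Main.v *)
(* Fix an SCC S of depth t, let F be its equations with the exact values of the
   deeper variables, m the least fixed point of F, and g <= F its equations
   with the computed values. If F'(m) d <= d with d > 0, each Newton step for g
   halves the bound a in p - x <= a d, where p is the least fixed point of g:
   monotonicity makes d work for every g <= F, so the rate is uniform. The
   positive vectors d and y with F'(m) d <= d and y F'(m) <= y exist because m
   is least and F'(m) is irreducible. Pairing with y shows that m - p is of the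
   order of the square root of the error in the deeper variables. Hence an error
   O(2^-(2K)) at depth > t gives O(2^-K) at depth t after K Newton steps, and
   the iteration counts j 2^t make the error at depth 0 O(2^-j). *)

Require Import Defs.
From mathcomp Require Import all_boot all_order all_algebra.
From mathcomp Require Import boolp reals.
From mathcomp Require Import mpoly.
From mathcomp Require Import ring lra.

Set Implicit Arguments.
Unset Strict Implicit.
Unset Printing Implicit Defensive.

Import Order.TTheory GRing.Theory Num.Theory.
Local Open Scope ring_scope.

(** * Nonnegative matrices *)

(** Expanding the equations of S around the deeper values shows that those values enter only the
    constant and the linear part, so F and g share one symmetric bilinear part B. The obstacle is
    that g may lose dependencies: a computed deeper value can be 0, for instance after zero Newton
    steps, so g need be neither clean nor strongly connected and its own Jacobian yields no uniform
    constants. Every certificate is therefore built from F and m. For the invertibility of 1 - g'(x)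
    and the nonnegativity of its inverse the certificate is v = m - x. Indeed v - g'(x) v is the sum
    of g(x) - x, m - g(m) and B(v, v), all nonnegative, and in a row where this sum vanishes the
    dependencies of F survive in g'(x). Eigenvalues are avoided: the cone vectors come from a linear
    system with one row replaced, and the bound on the spectral radius is stated as the absence of
    strict subsolutions. *)

Section NonnegativeMatrices.
Context {R : realFieldType}.

(* Unlike [mxE], these rules leave the entries of a matrix product alone. *)
Lemma mxDE m n (A B : 'M[R]_(m, n)) i j : (A + B) i j = A i j + B i j.
Proof. by rewrite mxE. Qed.

Lemma mxNE m n (A : 'M[R]_(m, n)) i j : (- A) i j = - A i j.
Proof. by rewrite mxE. Qed.

Lemma mxZE m n c (A : 'M[R]_(m, n)) i j : (c *: A) i j = c * A i j.
Proof. by rewrite mxE. Qed.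

Definition mxLE := (mxDE, mxNE, mxZE).

Definition nneg m n (A : 'M[R]_(m, n)) := forall i j, 0 <= A i j.

Lemma nnegD m n (A B : 'M[R]_(m, n)) : nneg A -> nneg B -> nneg (A + B).
Proof. by move=> hA hB i j; rewrite mxE addr_ge0. Qed.

Lemma nnegZ m n (c : R) (A : 'M[R]_(m, n)) : 0 <= c -> nneg A -> nneg (c *: A).
Proof. by move=> hc hA i j; rewrite mxE mulr_ge0. Qed.

Lemma nnegM m n p (A : 'M[R]_(m, n)) (B : 'M[R]_(n, p)) :
  nneg A -> nneg B -> nneg (A *m B).
Proof. by move=> hA hB i j; rewrite mxE sumr_ge0 // => k _; rewrite mulr_ge0. Qed.

Lemma nneg_tr m n (A : 'M[R]_(m, n)) : nneg A -> nneg A^T.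
Proof. by move=> hA i j; rewrite mxE. Qed.

Lemma nneg_trans m n (B A C : 'M[R]_(m, n)) :
  nneg (B - A) -> nneg (C - B) -> nneg (C - A).
Proof. by move=> h1 h2 i j; move: (h1 i j) (h2 i j); rewrite !mxE; lra. Qed.

Lemma mulmx_ge_term m n (A : 'M[R]_(m, n)) (u : 'cV[R]_n) i k :
  nneg A -> nneg u -> A i k * u k 0 <= (A *m u) i 0.
Proof.
move=> hA hu; rewrite mxE (bigD1 k) //= lerDl sumr_ge0 // => l _.
by rewrite mulr_ge0.
Qed.

Lemma mulmx_term_eq0 m n (A : 'M[R]_(m, n)) (u : 'cV[R]_n) i k :
  nneg A -> nneg u -> (A *m u) i 0 <= 0 -> 0 < A i k -> u k 0 = 0.
Proof.
move=> hA hu le0 Aik; apply/eqP; rewrite eq_le hu andbT.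
by rewrite -(pmulr_rle0 _ Aik); apply: le_trans le0; exact: mulmx_ge_term.
Qed.

Lemma vec_neq0 n (x : 'cV[R]_n) : x != 0 -> exists i, x i 0 != 0.
Proof.
move=> x0; apply/existsP; apply: contraR x0 => /existsPn h.
by apply/eqP/matrixP => i j; rewrite ord1 mxE; apply/eqP/negbNE/h.
Qed.

Lemma vec_bound n (x : 'cV[R]_n) (v : 'cV[R]_n) :
  (forall i, 0 < v i 0) -> exists2 c, 0 < c & forall i, x i 0 <= c * v i 0.
Proof.
(* The sum stands in for a maximum, so n = 0 needs no separate case; the added 1 keeps c
   positive. *)
move=> v0; exists (1 + \sum_k `|x k 0| / v k 0).
  rewrite ltr_pwDl // sumr_ge0 // => k _.
  by rewrite divr_ge0 // ltW.
move=> i; rewrite -ler_pdivrMr //.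
apply: (@le_trans _ _ (`|x i 0| / v i 0)).
  by rewrite ler_pM2r ?invr_gt0 // ler_norm.
rewrite (bigD1 i) //= addrCA lerDl addr_ge0 // sumr_ge0 // => k _.
by rewrite divr_ge0 // ltW.
Qed.

Lemma vec_bound_cst n (x : 'cV[R]_n) : exists2 c, 0 < c & forall i, x i 0 <= c.
Proof.
have [|c c0 h] := @vec_bound _ x (const_mx 1); first by move=> i; rewrite mxE.
by exists c => // i; have := h i; rewrite mxE mulr1.
Qed.

Lemma unitmx_of_injective n (A : 'M[R]_n) :
  (forall u : 'cV[R]_n, A *m u = 0 -> u = 0) -> A \in unitmx.
Proof.
move=> inj; rewrite -unitmx_tr -row_free_unit -kermx_eq0.
apply/rowV0P => x /sub_kermxP hx; rewrite -[x]trmxK (inj x^T) ?trmx0 //.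
by rewrite -[LHS]trmxK trmx_mul trmxK hx trmx0.
Qed.

Lemma exists_uniform_bound (T : finType) (P : T -> R -> Prop) :
    (forall x, exists2 C, 0 < C & P x C) ->
    (forall x C C', C <= C' -> P x C -> P x C') ->
  exists2 C, 0 < C & forall x, P x C.
Proof.
move=> ex mono.
suff [C C0 h] : exists2 C, 0 < C & forall x, x \in enum T -> P x C.
  by exists C => // x; apply: h; rewrite mem_enum.
elim: (enum T) => [|x s [C C0 IH]]; first by exists 1.
have [D D0 Dx] := ex x; exists (C + D); first exact: addr_gt0.
move=> y; rewrite inE => /predU1P[->|ys].
  by apply: mono Dx; rewrite lerDr ltW.
by apply: mono (IH _ ys); rewrite lerDl ltW.
Qed.

(** * Inverse positivity from a supersolution *)

Section Connected.
Context {N : nat} (e : rel 'I_N) (conn : forall i k, connect e i k).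

Lemma connect_propagate (D : 'I_N -> Prop) i :
  D i -> (forall k l, D k -> e k l -> D l) -> forall k, D k.
Proof.
move=> Di step k; have /connectP[p] := conn i k.
elim: p i Di => [|l p IH] i Di /=; first by move=> _ ->.
by move=> /andP[il pl]; apply: (IH l) => //; exact: step il.
Qed.

(* At an index minimising u_i / v_i the inequality u >= A u forces, if the
   minimum is negative, v_i = (A v)_i and the same ratio at every successor
   of i; by connectedness v = A v. *)
Lemma nneg_of_supersolution (A : 'M[R]_N) (v u : 'cV[R]_N) :
    nneg A -> (forall i, 0 < v i 0) ->
    nneg (v - A *m v) -> v - A *m v != 0 ->
    (forall i k, (v - A *m v) i 0 = 0 -> e i k -> 0 < A i k) ->
  nneg (u - A *m u) -> nneg u.
Proof.
move=> A0 v0 s0 /vec_neq0[i0 si0] edge hu.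
pose F i := u i 0 / v i 0.
case: (@arg_minP _ _ _ i0 xpredT F isT) => i _ imin.
set r := F i; have [r_ge0|r_lt0] := leP 0 r.
  move=> k j; rewrite ord1 -(@pmulr_lge0 _ (v k 0)^-1) ?invr_gt0 //.
  exact: le_trans (imin k isT).
exfalso.
have w0 : nneg (u - r *: v).
  move=> k j; rewrite ord1 !mxE subr_ge0 -ler_pdivlMr //; exact: imin.
have AwE k : (A *m (u - r *: v)) k 0 = (A *m u) k 0 - r * (A *m v) k 0.
  by rewrite mulmxBr -scalemxAr !mxLE.
pose D k := u k 0 = r * v k 0.
have DP k : D k -> (v - A *m v) k 0 = 0 /\ (A *m (u - r *: v)) k 0 = 0.
  move=> Dk; move: (hu k 0) (s0 k 0) (nnegM A0 w0 k 0).
  rewrite AwE !mxLE.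
  rewrite Dk => h1 h2 h3.
  have h4 : v k 0 - (A *m v) k 0 = 0.
    apply/eqP; rewrite eq_le h2 andbT; rewrite -(nmulr_rge0 _ r_lt0); lra.
  split=> //; nra.
have : forall k, D k.
  apply: (@connect_propagate D i).
    by rewrite /D /r /F divfK // gt_eqF.
  move=> k l Dk ekl; have [h1 h2] := DP k Dk.
  have := mulmx_term_eq0 (k := l) A0 w0 _ (edge k l h1 ekl).
  by rewrite h2 => /(_ (lexx _)); rewrite !mxE => /eqP; rewrite subr_eq0 => /eqP.
by move=> /(_ i0)/DP[/eqP]; rewrite (negPf si0).
Qed.

(** A kernel vector and its negative both satisfy the inequality of the preceding lemma, so both are
    nonnegative. Invertibility has to be proved at the iterates because [invmx] returns its argument
    on a singular matrix. *)
Lemma unitmx_of_supersolution (A : 'M[R]_N) (v : 'cV[R]_N) :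
    nneg A -> (forall i, 0 < v i 0) ->
    nneg (v - A *m v) -> v - A *m v != 0 ->
    (forall i k, (v - A *m v) i 0 = 0 -> e i k -> 0 < A i k) ->
  1%:M - A \in unitmx.
Proof.
move=> A0 v0 s0 sN edge; apply: unitmx_of_injective => u.
rewrite mulmxBl mul1mx => hu.
have u1 : nneg u.
  by apply: (nneg_of_supersolution A0 v0 s0 sN edge); rewrite hu => i j; rewrite mxE.
have u2 : nneg (- u).
  apply: (nneg_of_supersolution A0 v0 s0 sN edge).
  by rewrite mulmxN -opprD hu oppr0 => i j; rewrite mxE.
apply/matrixP => i j; rewrite [RHS]mxE; apply/eqP; rewrite eq_le u1 andbT.
by move: (u2 i j); rewrite [X in 0 <= X]mxE oppr_ge0.
Qed.

End Connected.

(** * Irreducible matrices and their cone vectors *)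

Section Irreducible.
Context {N : nat} (A : 'M[R]_N).
Hypothesis A0 : nneg A.
Hypothesis irr : forall i k, connect (fun i k => 0 < A i k) i k.

Lemma irreducible_eq0 (w : 'cV[R]_N) i :
  nneg w -> nneg (w - A *m w) -> w i 0 = 0 -> w = 0.
Proof.
move=> w0 hw wi; apply/matrixP => k j; rewrite ord1 [RHS]mxE; move: k {j}.
apply: (@connect_propagate _ _ irr (fun k => w k 0 = 0) i) => // k l wk kl.
apply: (mulmx_term_eq0 A0 w0 _ kl).
by move: (hw k 0); rewrite !mxLE wk sub0r oppr_ge0.
Qed.

(** A discrete Harnack inequality: an edge from k to l gives w_l <= (2 / A_kl) w_k, and these
    constants multiply along a path. The factor 1/2 leaves room for a perturbation of A. *)
Lemma irreducible_comparable :
  exists2 C, 0 < C & forall w : 'cV[R]_N, nneg w ->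
    nneg (w - 2^-1 *: (A *m w)) -> forall i k, w k 0 <= C * w i 0.
Proof.
pose P (x : 'I_N * 'I_N) C := forall w : 'cV[R]_N, nneg w ->
    nneg (w - 2^-1 *: (A *m w)) -> w x.2 0 <= C * w x.1 0.
have [[i k]|x C C' CC' h w w0 hw|C C0 h] := @exists_uniform_bound _ P.
- move: k; apply: (@connect_propagate _ _ irr (fun k => exists2 C, 0 < C & P (i, k) C) i).
    by exists 1 => // w w0 _; rewrite mul1r.
  move=> k l [C C0 h] kl; exists (C * 2 * (A k l)^-1).
    by rewrite !mulr_gt0 // invr_gt0.
  move=> w w0 hw; have := h w w0 hw; move: (hw k 0) (mulmx_ge_term k l A0 w0) => /=.
  rewrite !mxLE => h1 h2 h3.
  rewrite mulrAC -(@ler_pM2l _ (A k l)) // mulrCA divff ?gt_eqF // mulr1.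
  lra.
- by apply: (le_trans (h w w0 hw)); rewrite ler_wpM2r.
- by exists C => // w w0 hw i k; exact: (h (i, k)).
Qed.

(** Induction on the number of zeros of the slack A w - w. Connectedness gives an edge from a zero k
    to some l with slack t > 0. Raising w_l by t/2 keeps the slack at l positive, makes it positive
    at k, and lowers it at no other index. *)
Lemma irreducible_strict (w : 'cV[R]_N) :
    nneg w -> nneg (A *m w - w) -> A *m w - w != 0 ->
  exists2 w' : 'cV[R]_N, nneg w' & forall i, w' i 0 < (A *m w') i 0.
Proof.
pose Z (w : 'cV[R]_N) := [set i | (A *m w - w) i 0 == 0].
have [c] := ubnP #|Z w|; elim: c => // c IH in w * => lec w0 hw wN.
have [/eqP Z0|] := boolP (Z w == set0).
  exists w => // i; rewrite -subr_gt0 lt_neqAle.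
  move: (hw i 0) (in_set0 i); rewrite -Z0 inE !mxLE => -> /negbT.
  by rewrite eq_sym andbT.
case/set0Pn => i; rewrite inE => /eqP iZ.
have [k [l [kZ kl lZ]]] : exists k l, [/\ (A *m w - w) k 0 = 0, 0 < A k l &
    (A *m w - w) l 0 != 0].
  apply: contrapT => no; case/vec_neq0: wN => j /eqP; apply.
  apply: (@connect_propagate _ _ irr (fun k => (A *m w - w) k 0 = 0) i) => //.
  move=> k l kZ kl; apply: contrapT => /eqP lZ; apply: no.
  by exists k, l.
pose t := (A *m w - w) l 0.
have t0 : 0 < t by rewrite lt_neqAle eq_sym lZ hw.
pose w' := w + (t / 2) *: delta_mx l 0.
have E j : (A *m w' - w') j 0 =
    (A *m w - w) j 0 + t / 2 * A j l - t / 2 * (j == l)%:R.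
  rewrite /w' mulmxDr -scalemxAr -colE !mxLE [col _ _ _ _]mxE [delta_mx _ _ _ _]mxE eqxx andbT; lra.
have pos j : j != l -> 0 <= t / 2 * A j l by rewrite mulr_ge0 // divr_ge0 // ltW.
have posl : 0 <= t / 2 * A l l by rewrite mulr_ge0 // divr_ge0 // ltW.
have El : 0 < (A *m w' - w') l 0.
  by rewrite E eqxx -/t mulr1; move: t0 posl; lra.
apply: (IH w').
- rewrite -ltnS; apply: leq_trans lec; rewrite ltnS proper_card //.
  apply/properP; split.
    apply/subsetP => j; rewrite !inE E; have [->|jl] := eqVneq j l.
      rewrite -/t mulr1 => /eqP h; exfalso; move: t0 posl h; lra.
    by rewrite mulr0 subr0 paddr_eq0 ?pos // => /andP[].
  exists k; first by rewrite inE kZ.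
  rewrite inE E kZ; have [kl'|kl'] := eqVneq k l.
    by move: lZ; rewrite -kl' kZ eqxx.
  by rewrite mulr0 subr0 add0r mulf_neq0 // gt_eqF // divr_gt0.
- by apply: nnegD => //; apply: nnegZ; [rewrite divr_ge0 // ltW|move=> a b; rewrite mxE].
- move=> j j'; rewrite ord1; have [->|jl] := eqVneq j l; first exact: ltW.
  by rewrite E (negPf jl) mulr0 subr0 addr_ge0 // pos.
- by apply: contraTneq El => ->; rewrite mxE ltxx.
Qed.

(* The vector d is the solution of d = A d off the index i0, with d_{i0} = 1;
   the hypothesis says that A has spectral radius at most one. *)
Lemma irreducible_cone_vector (i0 : 'I_N) :
    (forall w : 'cV[R]_N, nneg w -> nneg (A *m w - w) -> A *m w = w) ->
  exists2 d : 'cV[R]_N, (forall i, 0 < d i 0) & nneg (d - A *m d).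
Proof.
move=> star.
have star0 (w : 'cV[R]_N) : nneg w -> nneg (A *m w - w) -> w i0 0 = 0 -> w = 0.
  move=> w0 hw wi; apply: (irreducible_eq0 w0 _ wi).
  by rewrite star // subrr => i j; rewrite mxE.
(* With row i0 replaced by zero, 1 - A' becomes invertible: the absolute values of a kernel vector
   form a subsolution of A vanishing at i0, which [star0] forces to be zero. *)
pose A' := \matrix_(i, k) (if i == i0 then 0 else A i k).
have A'E (u : 'cV[R]_N) i : (A' *m u) i 0 = if i == i0 then 0 else (A *m u) i 0.
  rewrite !mxE; case: ifP => h.
    by rewrite big1 // => k _; rewrite mxE h mul0r.
  by apply: eq_bigr => k _; rewrite mxE h.
have BU : 1%:M - A' \in unitmx.
  apply: unitmx_of_injective => u; rewrite mulmxBl mul1mx => /eqP.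
  rewrite subr_eq0 => /eqP hu; pose w : 'cV[R]_N := \col_i `|u i 0|.
  have uE i : u i 0 = if i == i0 then 0 else (A *m u) i 0 by rewrite -A'E -hu.
  have w0 : nneg w by move=> i j; rewrite mxE.
  suff /matrixP wE : w = 0.
    apply/matrixP => i j; rewrite ord1 [RHS]mxE; apply/eqP; rewrite -normr_eq0.
    by move: (wE i 0); rewrite !mxE => ->.
  apply: star0 => // [i j|]; last by rewrite mxE uE eqxx normr0.
  rewrite ord1 !mxLE subr_ge0 [leLHS]mxE uE; case: ifP => _.
    by rewrite normr0 nnegM.
  rewrite !mxE; apply: le_trans (ler_norm_sum _ _ _) _.
  by apply: ler_sum => k _; rewrite mxE normrM (ger0_norm (A0 _ _)).
pose d := invmx (1%:M - A') *m delta_mx i0 (0 : 'I_1).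
have dE i : d i 0 = (i == i0)%:R + if i == i0 then 0 else (A *m d) i 0.
  have : (1%:M - A') *m d = delta_mx i0 0 by rewrite mulKVmx.
  rewrite mulmxBl mul1mx => /matrixP/(_ i 0); rewrite !mxLE A'E.
  by rewrite [delta_mx _ _ _ _]mxE eqxx andbT => <-; rewrite subrK.
have di0 : d i0 0 = 1 by rewrite dE eqxx addr0.
have d0 : nneg d.
  (* The negative part of d is again a subsolution of A that vanishes at i0. *)
  pose w : 'cV[R]_N := \col_i Num.max 0 (- d i 0).
  have w0 : nneg w by move=> i j; rewrite mxE le_max lexx.
  have dw : nneg (d + w).
    move=> i j; have : - d i 0 <= w i 0 by rewrite [leRHS]mxE le_max lexx orbT.
    by rewrite ord1 mxLE; lra.
  suff /matrixP wE : w = 0.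
    by move=> i j; move: (dw i 0); rewrite ord1 mxLE wE [X in _ + X]mxE addr0.
  apply: star0 => // [i j|]; last by rewrite [LHS]mxE di0 max_l // oppr_le0.
  rewrite ord1 !mxLE subr_ge0 [leLHS]mxE ge_max nnegM //= dE.
  case: eqP => _; first by rewrite addr0 (le_trans (lerN10 _)) // nnegM.
  by rewrite add0r; have := nnegM A0 dw i 0; rewrite mulmxDr !mxLE; lra.
have Ad i : i != i0 -> d i 0 = (A *m d) i 0.
  by move=> /negPf ii0; rewrite {1}dE ii0 add0r.
(* Only row i0 is in question. If (A d)_{i0} exceeded d_{i0}, then d would be a subsolution, hence
   fixed by A. *)
have hd : nneg (d - A *m d).
  move=> i j; rewrite ord1 !mxLE; have [->|/Ad <-] := eqVneq i i0; last by rewrite subrr.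
  rewrite subr_ge0 leNgt; apply/negP => lt.
  move: (lt); rewrite star ?ltxx // => k l; rewrite ord1 !mxLE subr_ge0.
  by have [->|/Ad <-] := eqVneq k i0; [exact: ltW|].
exists d => // i; rewrite lt_neqAle eq_sym d0 andbT; apply/eqP => di.
have /matrixP/(_ i0 0) := irreducible_eq0 d0 hd di.
by rewrite di0 mxE => /eqP; rewrite oner_eq0.
Qed.

End Irreducible.

(** The condition on subsolutions passes to A^T by pairing with d: d (A^T w - w) = - (d - A d) w <=
    0, and since d > 0 the nonnegative vector A^T w - w must vanish. *)
Lemma irreducible_cone_vectors N (A : 'M[R]_N) (i0 : 'I_N) :
    nneg A -> (forall i k, connect (fun i k => 0 < A i k) i k) ->
    (forall w : 'cV[R]_N, nneg w -> nneg (A *m w - w) -> A *m w = w) ->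
  exists d y : 'cV[R]_N, [/\ forall i, 0 < d i 0, nneg (d - A *m d),
    forall i, 0 < y i 0 & nneg (y - A^T *m y)].
Proof.
move=> A0 irr star; have [d d0 hd] := irreducible_cone_vector A0 irr i0 star.
have irrT i k : connect (fun i k => 0 < A^T i k) i k.
  have : connect [rel x y | 0 < A y x] i k.
    by rewrite (connect_rev (fun i k => 0 < A i k)); exact: irr.
  by apply: connect_sub => x y; rewrite /= => Ayx; apply: connect1; rewrite mxE.
have [|y y0 hy] := irreducible_cone_vector (nneg_tr A0) irrT i0.
  move=> w w0 hw; apply/eqP; rewrite -subr_eq0; apply/eqP.
  have dw : d^T *m (A^T *m w - w) = - ((d - A *m d)^T *m w).
    by rewrite mulmxBr mulmxA -trmx_mul -mulmxBl -mulNmx -linearB -linearN opprB.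
  have le0 : (d^T *m (A^T *m w - w)) 0 0 <= 0.
    by rewrite dw mxLE oppr_le0; apply: nnegM => //; exact: nneg_tr.
  apply/matrixP => i j; rewrite ord1 [RHS]mxE.
  apply: (mulmx_term_eq0 _ hw le0); last by rewrite mxE.
  by apply: nneg_tr => k l; rewrite ord1 ltW.
by exists d, y; split.
Qed.

End NonnegativeMatrices.

(** * Newton's method for a perturbed quadratic map *)

Section QuadraticMaps.
Context {R : realType} {N : nat}.
Implicit Types (c x y v : 'cV[R]_N) (l : 'M[R]_N).

(** The matrix of y -> B(x, y), where B is the bilinear map with coefficients q; B is symmetric once
    [q i k j = q i j k]. *)
Definition contract (q : 'I_N -> 'I_N -> 'I_N -> R) x : 'M[R]_N :=
  \matrix_(i, k) \sum_j q i k j * x j 0.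

Definition qeval c l q x := c + l *m x + contract q x *m x.

Definition qjac l q x := l + 2 *: contract q x.

Definition qnewton c l q x :=
  x + invmx (1%:M - qjac l q x) *m (qeval c l q x - x).

Lemma qevalE c l q x i :
  qeval c l q x i 0 = c i 0 + (l *m x) i 0 + (contract q x *m x) i 0.
Proof. by rewrite /qeval !mxDE. Qed.

Section Identities.
Context (q : 'I_N -> 'I_N -> 'I_N -> R).

Lemma contractD x y : contract q (x + y) = contract q x + contract q y.
Proof.
apply/matrixP => i k; rewrite !mxE -big_split; apply: eq_bigr => j _ /=.
by rewrite mxE mulrDr.
Qed.

Lemma contractN x : contract q (- x) = - contract q x.
Proof.
apply/matrixP => i k; rewrite !mxE -sumrN; apply: eq_bigr => j _ /=.
by rewrite mxE mulrN.
Qed.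

Lemma contractZ a x : contract q (a *: x) = a *: contract q x.
Proof.
apply/matrixP => i k; rewrite !mxE mulr_sumr; apply: eq_bigr => j _ /=.
by rewrite mxE mulrCA.
Qed.

Hypothesis q0 : forall i k j, 0 <= q i k j.
Hypothesis qC : forall i k j, q i k j = q i j k.

Lemma contract_ge0 x : nneg x -> nneg (contract q x).
Proof. by move=> x0 i k; rewrite mxE sumr_ge0 // => j _; rewrite mulr_ge0. Qed.

Lemma contractC x y : contract q x *m y = contract q y *m x.
Proof.
apply/matrixP => i k; rewrite !mxE ord1.
under eq_bigr do rewrite mxE mulr_suml.
rewrite exchange_big; apply: eq_bigr => j _; rewrite mxE mulr_suml.
by apply: eq_bigr => h _; rewrite qC mulrAC.
Qed.

Lemma qjac_ge0 l x : nneg l -> nneg x -> nneg (qjac l q x).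
Proof. by move=> l0 x0; apply: nnegD => //; apply: nnegZ => //; exact: contract_ge0. Qed.

Lemma qjac_le l l' x y :
  nneg (l' - l) -> nneg (y - x) -> nneg (qjac l' q y - qjac l q x).
Proof.
move=> hl /contract_ge0 hx i k; move: (hl i k) (hx i k).
by rewrite contractD contractN !mxLE; lra.
Qed.

Lemma qeval_taylor c l x v :
  qeval c l q (x + v) = qeval c l q x + qjac l q x *m v + contract q v *m v.
Proof.
rewrite /qeval /qjac contractD !mulmxDr !mulmxDl -scalemxAl (contractC v x).
by apply/matrixP => i k; rewrite ord1 !mxLE; lra.
Qed.

Lemma qeval_ge0 c l x : nneg c -> nneg l -> nneg x -> nneg (qeval c l q x).
Proof.
move=> c0 l0 x0; apply: nnegD; [apply: nnegD => //|]; apply: nnegM => //.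
exact: contract_ge0.
Qed.

Lemma qeval_mono c l x y :
  nneg l -> nneg x -> nneg (y - x) -> nneg (qeval c l q y - qeval c l q x).
Proof.
move=> l0 x0; rewrite -{2}[y](subrKC x); move: (y - x) => v v0.
rewrite qeval_taylor -[X in X - _]addrA [X in nneg X]addrAC subrr add0r.
apply: nnegD; apply: nnegM => //; [exact: qjac_ge0|exact: contract_ge0].
Qed.

Lemma qeval_coef_le c c' l l' x : nneg x -> nneg (c' - c) -> nneg (l' - l) ->
  nneg (qeval c' l' q x - qeval c l q x).
Proof.
move=> x0 hc hl i k; move: (hc i k) (nnegM hl x0 i k).
by rewrite ord1 mulmxBl !mxLE; lra.
Qed.

End Identities.
End QuadraticMaps.

Definition qdep {R : realType} {N} (l : 'M[R]_N) (q : 'I_N -> 'I_N -> 'I_N -> R)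
  : rel 'I_N := fun i k => (0 < l i k) || [exists j, 0 < q i k j].

Section PerturbedNewton.
Context {R : realType} {N : nat}.
Context (q : 'I_N -> 'I_N -> 'I_N -> R) (cF cg : 'cV[R]_N) (lF lg : 'M[R]_N).
Context (m p d : 'cV[R]_N).
Hypothesis q0 : forall i k j, 0 <= q i k j.
Hypothesis qC : forall i k j, q i k j = q i j k.
Hypothesis cg0 : nneg cg.
Hypothesis lg0 : nneg lg.
Hypothesis cgF : nneg (cF - cg).
Hypothesis lgF : nneg (lF - lg).
Hypothesis m0 : forall i, 0 < m i 0.
Hypothesis mE : qeval cF lF q m = m.
Hypothesis irr : forall i k, connect (qdep lF q) i k.
Hypothesis p0 : nneg p.
Hypothesis pE : qeval cg lg q p = p.
Hypothesis p_least : forall z, nneg z -> nneg (z - qeval cg lg q z) -> nneg (z - p).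
Hypothesis d0 : forall i, 0 < d i 0.
Hypothesis hd : nneg (d - qjac lF q m *m d).

Let g := qeval cg lg q.

(** Strict inequality in every coordinate makes m - x an admissible certificate. The other
    alternative covers an iterate that has hit a fixed point: 1 - g'(x) may be singular there, but
    the step is zero whatever [invmx] returns. *)
Definition newton_inv (x : 'cV[R]_N) := [/\ nneg x, nneg (g x - x), nneg (p - x) &
  (forall i, x i 0 < m i 0) \/ g x = x].

Lemma perturbed_prefix : nneg (m - g m).
Proof.
rewrite -{1}mE; apply: qeval_coef_le => //.
by move=> i j; rewrite ord1 ltW.
Qed.

Lemma perturbed_fix_le : nneg (m - p).
Proof.
apply: p_least; last exact: perturbed_prefix.
by move=> i j; rewrite ord1 ltW.
Qed.

(* A dependency of i through the quadratic part makes (B(v, v))_i positive, and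
   one lost in the perturbation makes g(m)_i smaller than m_i. *)
Lemma perturbed_edge (x v : 'cV[R]_N) i k : nneg x -> (forall i, 0 < v i 0) ->
    (m - g m) i 0 + (contract q v *m v) i 0 = 0 -> qdep lF q i k ->
  0 < qjac lg q x i k.
Proof.
move=> x0 v0; have v0' : nneg v by move=> a b; rewrite ord1 ltW.
have m0' : nneg m by move=> a b; rewrite ord1 ltW.
have c1 := contract_ge0 q0 v0'.
have h1 := perturbed_prefix i 0; have h2 := nnegM c1 v0' i 0.
move=> /eqP; rewrite paddr_eq0 // => /andP[/eqP mg /eqP cv].
case/orP => [lFik|/existsP[j qikj]].
  have : lF i k = lg i k.
    have E : (m - g m) i 0 = (cF - cg) i 0 + ((lF - lg) *m m) i 0.
      by rewrite -{1}mE /g mulmxBl /qeval !mxLE; lra.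
    move: mg; rewrite E => /eqP; rewrite paddr_eq0 ?nnegM // => /andP[_ /eqP h].
    have h' : (lF - lg) i k <= 0.
      have := mulmx_ge_term i k lgF m0'; rewrite h pmulr_lle0 //.
    have := lgF i k; move: h'; rewrite !mxLE; lra.
  move=> E; rewrite /qjac !mxLE -E ltr_pwDl // mulr_ge0 //; exact: contract_ge0.
exfalso; have := mulmx_ge_term i k c1 v0'; rewrite cv pmulr_lle0 // => h.
suff : 0 < contract q v i k by rewrite ltNge h.
rewrite mxE (bigD1 j) //= ltr_pwDl ?mulr_gt0 // sumr_ge0 // => a _.
by rewrite mulr_ge0.
Qed.

Lemma newton_inv0 : newton_inv 0.
Proof.
split.
- by move=> i j; rewrite mxE.
- by rewrite subr0 /g /qeval !mulmx0 !addr0.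
- by rewrite subr0.
- by left=> i; rewrite mxE.
Qed.

(** Put A = g'(x) and e = p - x. The new error z satisfies z - A z = B(e, e). From d >= F'(m) d >=
    g'(p) d = A d + 2 B(e, d) and e <= a d follows B(e, e) <= a B(e, d) <= (a/2) (d - A d), and
    inverse positivity of 1 - A gives z <= (a/2) d. *)
Lemma newton_step (x : 'cV[R]_N) : newton_inv x ->
  newton_inv (qnewton cg lg q x) /\
  forall a, 0 <= a -> nneg (a *: d - (p - x)) ->
    nneg ((a / 2) *: d - (p - qnewton cg lg q x)).
Proof.
move=> [x0 hx px Hx]; rewrite /qnewton -/(g x).
have dn : nneg d by move=> i j; rewrite ord1 ltW.
have [gx|gxN] := eqVneq (g x) x.
  rewrite gx subrr mulmx0 addr0; split; first by split=> //; right.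
  move=> a a0 _; have h := p_least x0; rewrite -/(g x) gx subrr in h.
  have {}h : nneg (x - p) by apply: h => i j; rewrite mxE.
  move=> i j; move: (h i j) (nnegZ (divr_ge0 a0 (ler0n R 2)) dn i j).
  by rewrite !mxLE; lra.
case: Hx => [xm|/eqP]; last by rewrite (negPf gxN).
set A := qjac lg q x; set v := m - x.
have v0 i : 0 < v i 0 by rewrite !mxLE subr_gt0.
have vn : nneg v by move=> i j; rewrite ord1 ltW.
have A0 : nneg A by exact: qjac_ge0.
have sE : v - A *m v = (g x - x) + (m - g m + contract q v *m v).
  have -> : g m = g x + A *m v + contract q v *m v.
    by rewrite -qeval_taylor // /v subrKC.
  by apply/matrixP => i j; rewrite ord1 !mxLE; lra.
have wn : nneg (m - g m + contract q v *m v).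
  by apply: nnegD; [exact: perturbed_prefix|exact: nnegM (contract_ge0 q0 vn) vn].
have s0 : nneg (v - A *m v) by rewrite sE; exact: nnegD.
have sN : v - A *m v != 0.
  apply: contraNneq gxN => sZ; rewrite -subr_eq0; apply/eqP/matrixP => i j.
  have E : (g x - x) i j + (m - g m + contract q v *m v) i j = 0.
    by rewrite -mxDE -sE sZ mxE.
  by rewrite [RHS]mxE; move: (hx i j) (wn i j) E; lra.
have edge i k : (v - A *m v) i 0 = 0 -> qdep lF q i k -> 0 < A i k.
  rewrite sE mxDE => si; apply: (perturbed_edge x0 v0); rewrite -mxDE.
  by move: (wn i 0) (hx i 0) si; lra.
have inv_nneg := nneg_of_supersolution irr A0 v0 s0 sN edge.
have U := unitmx_of_supersolution irr A0 v0 s0 sN edge.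
set u := invmx _ *m _.
have uE : u - A *m u = g x - x by rewrite -{1}[u]mul1mx -mulmxBl mulKVmx.
have u0 : nneg u by apply: inv_nneg; rewrite uE.
have gN : g (x + u) = x + u + contract q u *m u.
  rewrite /g qeval_taylor // -/(g x) -/A.
  by move/matrixP: uE => uE; apply/matrixP => i j; have := uE i j; rewrite ord1 !mxLE; lra.
pose e := p - x.
have eE : (p - (x + u)) - A *m (p - (x + u)) = contract q e *m e.
  have T : g p = g x + A *m e + contract q e *m e.
    by rewrite -qeval_taylor // /e subrKC.
  rewrite [g p]pE in T; rewrite opprD addrA mulmxBr.
  apply/matrixP => i j; move/matrixP/(_ i j): T; move/matrixP/(_ i j): uE.
  by rewrite ord1 !mxLE; lra.
have pN : nneg (p - (x + u)).
  by apply: inv_nneg; rewrite eE; exact: nnegM (contract_ge0 q0 px) px.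
split; last first.
  move=> a a0 ha; apply: inv_nneg.
  have pm := perturbed_fix_le.
  have hJ : nneg (d - A *m d - 2 *: (contract q e *m d)).
    have hjac : nneg ((qjac lF q m - qjac lg q p) *m d).
      by apply: nnegM => //; exact: qjac_le.
    have AE : qjac lg q p *m d = A *m d + 2 *: (contract q e *m d).
      rewrite scalemxAl -mulmxDl /A /qjac /e contractD contractN; congr (_ *m d).
      by apply/matrixP => i j; rewrite !mxLE; lra.
    move=> i j; move: (hd i j) (hjac i j); rewrite mulmxBl AE.
    by rewrite ord1 !mxLE; lra.
  have hC := nnegM (contract_ge0 q0 px) ha.
  have hJ' := nnegZ (divr_ge0 a0 (ler0n R 2)) hJ.
  move: eE hC hJ'; rewrite -/e; set z := p - (x + u) => zE.
  rewrite [contract q e *m (a *: d - e)]mulmxBr -scalemxAr => hC hJ'.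
  rewrite [A *m ((a / 2) *: d - z)]mulmxBr -scalemxAr => i j.
  move: (hC i j) (hJ' i j); move/matrixP/(_ i j): zE.
  by rewrite ord1 !mxLE; lra.
split=> //.
- exact: nnegD.
- by rewrite gN => i j; rewrite addrAC subrr add0r; exact: nnegM (contract_ge0 q0 u0) u0 i j.
(* If the new iterate touches m in one coordinate, then there both A z and the slack of v vanish.
   The dependencies out of it survive in A, so the contact spreads to every coordinate; the new
   iterate is m, and m is a fixed point of g. *)
pose z := m - (x + u).
have zE : z - A *m z = m - g m + contract q v *m v.
  rewrite /z opprD addrA -/v mulmxBr; apply/matrixP => i j.
  by move/matrixP/(_ i j): uE; move/matrixP/(_ i j): sE; rewrite ord1 !mxLE; lra.
have z0 : nneg z by apply: inv_nneg; rewrite zE.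
have [zi|/existsNP[i zi]] := pselect (forall i, 0 < z i 0).
  by left=> i; have := zi i; rewrite /z !mxLE; lra.
right; have {}zi : z i 0 = 0.
  by apply/eqP; move/negP: zi; rewrite lt_neqAle z0 andbT negbK eq_sym.
have zZ k : z k 0 = 0 /\ (m - g m) k 0 = 0.
  have W h : z h 0 = 0 -> (m - g m + contract q v *m v) h 0 = 0 /\ (A *m z) h 0 = 0.
    move=> zh; have := wn h 0; have := nnegM A0 z0 h 0.
    by rewrite -zE mxDE mxNE zh => h1 h2; split; lra.
  have zk : z k 0 = 0.
    apply: (connect_propagate irr (D := fun k => z k 0 = 0) zi) => a b za ab.
    have [w1 w2] := W a za.
    apply: (mulmx_term_eq0 (A := A) (i := a) A0 z0); first by rewrite w2.
    by apply: (perturbed_edge x0 v0 _ ab); rewrite -mxDE.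
  have [w1 _] := W k zk; split=> //; move/eqP: w1.
  rewrite mxDE paddr_eq0 ?perturbed_prefix //; first by move=> /andP[/eqP].
  exact: nnegM (contract_ge0 q0 vn) vn k 0.
have -> : x + u = m.
  by apply/matrixP => k j; rewrite ord1; have [+ _] := zZ k; rewrite /z !mxLE; lra.
by apply/matrixP => k j; rewrite ord1; have [_ +] := zZ k; rewrite !mxLE; lra.
Qed.

Lemma newton_converges a K : 0 <= a -> nneg (a *: d - m) ->
  newton_inv (iter K (qnewton cg lg q) 0) /\
  nneg ((a / 2 ^+ K) *: d - (p - iter K (qnewton cg lg q) 0)).
Proof.
move=> a0 ha; elim: K => [|K [IH1 IH2]].
  split; first exact: newton_inv0.
  rewrite expr0 divr1 subr0; exact: nneg_trans perturbed_fix_le ha.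
have [h1 h2] := newton_step IH1; split; first exact: h1.
rewrite iterS exprSr invfM mulrA; apply: h2 => //.
by rewrite divr_ge0 // exprn_ge0.
Qed.

End PerturbedNewton.

(** * Sensitivity of the least fixed point *)

Section KnasterTarski.
Context {R : realType} {N : nat} (G : 'cV[R]_N -> 'cV[R]_N).
Hypothesis G0 : forall x, nneg x -> nneg (G x).
Hypothesis Gmono : forall x y, nneg x -> nneg (y - x) -> nneg (G y - G x).

(** The point is the componentwise infimum of the nonnegative prefixed points, so monotonicity
    suffices and no continuity enters. *)
Lemma least_prefixpoint z0 : nneg z0 -> nneg (z0 - G z0) ->
  exists p, [/\ nneg p, G p = p &
    forall z, nneg z -> nneg (z - G z) -> nneg (z - p)].
Proof.
move=> z00 hz0.
pose S i : classical_sets.set R := fun r => exists z, [/\ nneg z, nneg (z - G z) & r = z i 0].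
have Snon i : classical_sets.nonempty (S i) by exists (z0 i 0), z0.
have Slb i : classical_sets.lbound (S i) 0 by move=> r [z [z1 _ ->]].
pose p : 'cV[R]_N := \col_i inf (S i).
have ple z : nneg z -> nneg (z - G z) -> nneg (z - p).
  move=> z1 z2 i j; rewrite ord1 !mxLE subr_ge0 [leLHS]mxE.
  by apply: ge_inf; [exists 0; exact: Slb|exists z].
have p0 : nneg p by move=> i j; rewrite mxE lb_le_inf.
have Gp : nneg (p - G p).
  move=> i j; rewrite ord1 !mxLE subr_ge0 [leRHS]mxE lb_le_inf // => r [z [z1 z2 ->]].
  by move: (Gmono p0 (ple z z1 z2) i 0) (z2 i 0); rewrite !mxLE; lra.
have pG : nneg (G p - p) by apply: ple; [exact: G0|apply: Gmono => //; exact: G0].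
exists p; split=> //; apply/matrixP => i j; apply/eqP; rewrite eq_le.
by move: (Gp i j) (pG i j); rewrite !mxLE !subr_ge0 => -> ->.
Qed.

End KnasterTarski.

Section Sensitivity.
Context {R : realType} {N : nat}.
Context (q : 'I_N -> 'I_N -> 'I_N -> R) (cF : 'cV[R]_N) (lF : 'M[R]_N).
Context (m : 'cV[R]_N) (i0 : 'I_N).
Hypothesis q0 : forall i k j, 0 <= q i k j.
Hypothesis qC : forall i k j, q i k j = q i j k.
Hypothesis cF0 : nneg cF.
Hypothesis lF0 : nneg lF.
Hypothesis m0 : forall i, 0 < m i 0.
Hypothesis mE : qeval cF lF q m = m.
Hypothesis m_least : forall z, nneg z -> nneg (m - z) ->
  nneg (z - qeval cF lF q z) -> z = m.
Hypothesis irr : forall i k, connect (qdep lF q) i k.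

Let A := qjac lF q m.

Let mn : nneg m. Proof. by move=> i j; rewrite ord1 ltW. Qed.

Let A0 : nneg A. Proof. exact: qjac_ge0. Qed.

(** As m is positive, each quadratic dependency contributes a positive entry of F'(m). *)
Lemma fixpoint_jacobian_irreducible i k : connect (fun i k => 0 < A i k) i k.
Proof.
apply: connect_sub (irr i k) => {}i {}k /orP[lik|/existsP[j qj]];
  apply: connect1; rewrite /A /qjac !mxLE.
  by rewrite ltr_pwDl // mulr_ge0 //; exact: contract_ge0.
rewrite ltr_wpDl // mulr_gt0 // mxE (bigD1 j) //= ltr_pwDl ?mulr_gt0 //.
by rewrite sumr_ge0 // => a _; rewrite mulr_ge0.
Qed.

(* Otherwise m - t w' would be a smaller prefixed point, for some w' and all
   small t > 0. *)
Lemma least_fixpoint_jacobian (w : 'cV[R]_N) :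
  nneg w -> nneg (A *m w - w) -> A *m w = w.
Proof.
move=> w0 hw; apply/eqP; rewrite -subr_eq0; apply/negPn/negP => wN.
have [w' w'0 hw'] := irreducible_strict A0 fixpoint_jacobian_irreducible w0 hw wN.
have sw i : 0 < (A *m w' - w') i 0 by rewrite !mxLE subr_gt0.
have [C1 C10 h1] := vec_bound w' m0.
have [C2 C20 h2] := vec_bound (contract q w' *m w') sw.
(* F(m - t w') = m - t A w' + t^2 B(w', w'). The share of C1 keeps m - t w' nonnegative, and that of
   C2 gives t B(w', w') <= A w' - w'. *)
pose t := (C1 + C2)^-1.
have t0 : 0 < t by rewrite invr_gt0 addr_gt0.
have tE : t * (C1 + C2) = 1 by rewrite mulVf // gt_eqF // addr_gt0.
have hz : m - t *: w' = m.
  apply: m_least.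
  - move=> i j; rewrite ord1 !mxLE; move: (h1 i) (w'0 i 0) (m0 i) => a b c.
    have : t * (w' i 0) <= t * (C1 * m i 0) by rewrite ler_pM2l.
    have : 0 <= (t * C2) * m i 0 by rewrite !mulr_ge0 // ltW.
    by rewrite mulrA -[X in _ - _ * X]mulr1; move: tE; rewrite mulrDr => tE; nra.
  - by rewrite opprB addrC subrK; exact: nnegZ (ltW t0) w'0.
  - rewrite -scaleNr qeval_taylor // mE -/A => i j; rewrite ord1.
    rewrite contractZ -scalemxAl -!scalemxAr !mxLE.
    have := h2 i; rewrite !mxLE; have := hw' i.
    set Q := (contract _ _ *m _) i 0; set a := (A *m _) i 0; set b := w' i 0.
    move=> ab hQ; have : t * Q <= t * (C2 * (a - b)) by rewrite ler_pM2l.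
    have : 0 <= (t * C1) * (a - b) by rewrite !mulr_ge0 ?subr_ge0 // ltW.
    move=> e1 e2; have : t * Q <= a - b by nra.
    by move=> e3; have : t * (t * Q) <= t * (a - b) by [rewrite ler_pM2l|]; lra.
have w'Z : w' = 0.
  move/eqP: hz; rewrite -subr_eq0 addrAC subrr add0r oppr_eq0 scaler_eq0.
  by rewrite (gt_eqF t0) => /eqP.
by have := hw' i0; rewrite w'Z mulmx0 ltxx.
Qed.

(* With e = m - p, r = F(m) - g(m), and y a left cone vector of A = F'(m),
   [e = r + g'(m) e - B(e, e)] gives [y (e - A e) + y B(e, e) <= y r]. All
   components of e are comparable, because [e >= A e / 2] once g is close to F.
   So either B is nonzero and e^2 = O(r), or B = 0, [y A <> y] and e = O(r). *)
Lemma fixpoint_sensitivity : exists2 C, 0 < C &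
  forall (cg : 'cV[R]_N) (lg : 'M[R]_N) (p : 'cV[R]_N) (t : R),
    nneg cg -> nneg lg -> nneg (cF - cg) -> nneg (lF - lg) -> 0 <= t ->
    (forall i, cF i 0 - cg i 0 <= t ^+ 2) ->
    (forall i k, lF i k - lg i k <= t ^+ 2) ->
    nneg p -> qeval cg lg q p = p -> nneg (m - p) ->
  forall i, m i 0 - p i 0 <= C * t.
Proof.
have [d [y [_ _ y0 hy]]] :=
  irreducible_cone_vectors i0 A0 fixpoint_jacobian_irreducible least_fixpoint_jacobian.
have yn : nneg y by move=> i j; rewrite ord1 ltW.
have [Ck Ck0 cmp] := irreducible_comparable A0 fixpoint_jacobian_irreducible.
have [Cm Cm0 mCm] := vec_bound_cst m.
(* 1/T bounds the positive entries of lF from below, so for small t^2 no entry loses more than half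
   of its value. *)
have [T T0 hT] : exists2 T, 0 < T & forall x : 'I_N * 'I_N, 0 < lF x.1 x.2 -> 1 <= T * lF x.1 x.2.
  apply: exists_uniform_bound => [[i k]|x C C' CC' h l0] /=.
    have [l0|_] := ltP 0 (lF i k); last by exists 1.
    by exists (lF i k)^-1 => [|_]; rewrite ?invr_gt0 // mulVf // gt_eqF.
  by apply: (le_trans (h l0)); rewrite ler_pM2r.
(* Each r_i is at most t^2 (1 + sum of the m_k), hence y r <= t^2 M. *)
pose M := (1 + \sum_k m k 0) * \sum_i y i 0.
have Y (x : 'cV[R]_N) : (y^T *m x) 0 0 = \sum_i y i 0 * x i 0.
  by rewrite !mxE; apply: eq_bigr => i _; rewrite mxE.
have [D D0 key] : exists2 D, 0 < D & forall (e : 'cV[R]_N) t, nneg e -> 0 <= t -> t <= 1 ->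
    (forall i k, e k 0 <= Ck * e i 0) ->
    ((y - A^T *m y)^T *m e) 0 0 + (y^T *m (contract q e *m e)) 0 0 <= t ^+ 2 * M ->
  forall i, e i 0 <= D * t.
  have Mpos : 0 <= M.
    rewrite mulr_ge0 //; last by apply: sumr_ge0 => i _.
    by rewrite addr_ge0 // sumr_ge0.
  have [[i1 [k1 [j1 qpos]]]|noq] := pselect (exists i k j, 0 < q i k j).
    (* The single term s e_{k1} e_{j1} of y B(e, e) is at most t^2 M, and comparability bounds e_i^2
       by Ck^2 e_{k1} e_{j1}. *)
    pose s := y i1 0 * q i1 k1 j1; have s0 : 0 < s by rewrite mulr_gt0.
    exists (1 + Ck ^+ 2 * (M / s)).
      by rewrite ltr_pwDl // mulr_ge0 ?exprn_ge0 // ?divr_ge0 // ltW.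
    move=> e t e0 t0 t1 ecmp h i.
    have qe : s * (e k1 0 * e j1 0) <= t ^+ 2 * M.
      apply: le_trans h; apply: ler_wpDl; first by apply: nnegM => //; exact: nneg_tr.
      have ce := contract_ge0 q0 e0.
      have := mulmx_ge_term 0 i1 (nneg_tr yn) (nnegM ce e0).
      apply: le_trans; rewrite mxE /s -mulrA ler_pM2l // mulrA.
      apply: le_trans (mulmx_ge_term i1 k1 ce e0); rewrite [leLHS]mulrAC ler_wpM2r //.
      rewrite mxE (bigD1 j1) //= lerDl sumr_ge0 // => a _; exact: mulr_ge0.
    set K := Ck ^+ 2 * (M / s); have K0 : 0 <= K.
      by rewrite mulr_ge0 ?exprn_ge0 // ?divr_ge0 // ltW.
    have e2 : e i 0 ^+ 2 <= K * t ^+ 2.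
      have a1 : e i 0 ^+ 2 <= Ck ^+ 2 * (e k1 0 * e j1 0).
        have -> : Ck ^+ 2 * (e k1 0 * e j1 0) = (Ck * e k1 0) * (Ck * e j1 0) by ring.
        by rewrite expr2 ler_pM.
      apply: (le_trans a1); rewrite /K -mulrA ler_pM2l ?exprn_gt0 //.
      by rewrite mulrAC ler_pdivlMr // mulrC [M * _]mulrC.
    rewrite -ler_sqr ?nnegrE ?mulr_ge0 ?addr_ge0 //; apply: (le_trans e2).
    rewrite exprMn ler_wpM2r ?exprn_ge0 //; nra.
  have q0' i k j : q i k j = 0.
    by apply/eqP; rewrite eq_le q0 andbT leNgt; apply/negP => ?; apply: noq; exists i, k, j.
  have cZ x : contract q x = 0.
    by apply/matrixP => i k; rewrite !mxE big1 // => j _; rewrite q0' mul0r.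
  (* If B = 0 and y A = y, then A = lF, and pairing m = cF + lF m with y gives y cF = 0, so cF = 0.
     Then 0 is a fixed point of F, contrary to m > 0 being least. *)
  have yN : y - A^T *m y != 0.
    apply/eqP => yZ.
    have AE : A = lF by rewrite /A /qjac cZ scaler0 addr0.
    have ycF : (y^T *m cF) 0 0 = 0.
      have : (y^T *m m) 0 0 = (y^T *m cF) 0 0 + (y^T *m m) 0 0.
        rewrite -{1}mE /qeval cZ mul0mx addr0 mulmxDr mxDE; congr (_ + _).
        have /eqP : y - A^T *m y = 0 by [].
        rewrite subr_eq0 => /eqP {2}->.
        by rewrite trmx_mul trmxK -mulmxA AE.
      lra.
    have cFZ : cF = 0.
      apply/matrixP => i j; rewrite ord1 [RHS]mxE.
      by apply: (mulmx_term_eq0 (nneg_tr yn) cF0 (i := 0)); rewrite ?ycF // mxE.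
    have zz : nneg (0 : 'cV[R]_N) by move=> i j; rewrite mxE.
    have := m_least zz; rewrite subr0 /qeval cFZ !mulmx0 !addr0 subr0 => /(_ mn zz) mZ.
    by have := m0 i0; rewrite -mZ mxE ltxx.
  have [k1 sN] := vec_neq0 yN; set s := (y - A^T *m y) k1 0 in sN.
  have s0 : 0 < s by rewrite lt_neqAle eq_sym sN hy.
  exists (1 + Ck * (M / s)).
    by rewrite ltr_pwDl // mulr_ge0 ?divr_ge0 // ltW.
  move=> e t e0 t0 t1 ecmp; rewrite cZ mul0mx mulmx0 [X in _ + X]mxE addr0 => h i.
  have he : s * e k1 0 <= t ^+ 2 * M.
    by apply: le_trans h; have := mulmx_ge_term 0 k1 (nneg_tr hy) e0; rewrite mxE.
  have he' : e k1 0 <= t * (M / s).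
    rewrite mulrA ler_pdivlMr // mulrC; apply: (le_trans he).
    by apply: ler_wpM2r => //; rewrite expr2 ler_piMr.
  apply: (le_trans (ecmp k1 i)); rewrite mulrDl mul1r ler_wpDl //.
  by rewrite -mulrA ler_pM2l // mulrC.
exists (D + Cm * (1 + 2 * T)); first by rewrite addr_gt0 ?mulr_gt0 ?addr_gt0 ?mulr_gt0.
move=> cg lg p t cg0 lg0 hc hl t0 tc tl p0 pE pm i.
(* For large t the bound is trivial, since m - p <= m <= Cm and t (1 + 2 T) >= 1. *)
have [small|big] := leP (t ^+ 2 * (1 + 2 * T)) 1; last first.
  have : 1 <= t * (1 + 2 * T).
    have [t1|t1] := leP 1 t; first by rewrite mulr_ege1 // lerDl mulr_ge0 // ltW.
    apply: le_trans (ltW big) _; apply: ler_wpM2r; first by rewrite addr_ge0 ?mulr_ge0 ?ltW.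
    by rewrite expr2 ler_piMr // ltW.
  move=> ht; have : Cm <= Cm * (t * (1 + 2 * T)) by rewrite ler_peMr // ltW.
  have : 0 <= D * t by rewrite mulr_ge0 // ltW.
  by have := mCm i; have := p0 i 0; nra.
have t1 : t <= 1.
  rewrite -(@ler_sqr _ t 1) ?nnegrE // expr1n; apply: le_trans small.
  by rewrite ler_peMr ?exprn_ge0 // lerDl mulr_ge0 // ltW.
have hlg j k : lF j k <= 2 * lg j k.
  have [l0|l0] := ltP 0 (lF j k); last first.
    by apply: (le_trans l0); rewrite mulr_ge0.
  have := hT (j, k) l0; have := tl j k => /= a1 a2.
  have : t ^+ 2 * (2 * T) * lF j k <= 1 * lF j k.
    rewrite ler_pM2r //; apply: le_trans small.
    by apply: ler_wpM2l; rewrite ?exprn_ge0 // lerDr.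
  have : t ^+ 2 * 1 <= t ^+ 2 * (T * lF j k) by rewrite ler_wpM2l ?exprn_ge0.
  nra.
pose e := m - p.
pose r := (cF - cg) + (lF - lg) *m m.
have T1 : m = qeval cg lg q m + r.
  by rewrite -{1}mE /r mulmxBl /qeval; apply/matrixP => a b; rewrite !mxLE; lra.
have pe : m = p + e by rewrite /e subrKC.
have T2 : qeval cg lg q m = p + qjac lg q p *m e + contract q e *m e.
  by rewrite {1}pe qeval_taylor // pE.
have mnC := contract_ge0 q0 mn.
have r0 : nneg r by apply: nnegD => //; exact: nnegM.
have Yr : (y^T *m r) 0 0 <= t ^+ 2 * M.
  rewrite Y /M mulrA mulr_sumr; apply: ler_sum => a _; rewrite mulrC ler_pM2r //.
  rewrite /r mxDE mulrDr mulr1 lerD //; first by rewrite !mxLE.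
  rewrite mxE mulr_sumr; apply: ler_sum => k _; rewrite ler_wpM2r //.
  by rewrite !mxLE.
have -> : m i 0 - p i 0 = e i 0 by rewrite /e !mxLE.
have e0 : nneg e := pm.
have eC := contract_ge0 q0 e0.
clearbody e r.
(* Since A = lF + 2 B(p) + 2 B(e) and lF <= 2 lg, half of A e is at most lg e + 2 B(p, e) + B(e, e)
   = e - r. *)
have eA : nneg (e - 2^-1 *: (A *m e)).
  have L : nneg ((2 *: lg - lF) *m e).
    by apply: nnegM => // a b; rewrite !mxLE subr_ge0.
  have P := nnegM (contract_ge0 q0 p0) e0.
  move=> a b; move: (L a b) (P a b) (r0 a b) => {}L {}P {}r0.
  move/matrixP/(_ a b): T1; move: L; rewrite T2 /A /qjac {2}pe contractD.
  rewrite mulmxBl !mulmxDl -!scalemxAl !mulmxDl !mxLE.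
  have -> : m a b = p a b + e a b by rewrite -mxDE -pe.
  by move: (nnegM eC e0 a b); lra.
have key_e := key e t e0 t0 t1 (cmp e e0 eA).
have D' : D * t <= (D + Cm * (1 + 2 * T)) * t.
  by apply: ler_wpM2r => //; rewrite lerDl !mulr_ge0 ?addr_ge0 ?mulr_ge0 // ltW.
apply: le_trans D'; apply: key_e.
have H : nneg (r - (e - A *m e + contract q e *m e)).
  have hJ : nneg ((A - qjac lg q m) *m e).
    apply: nnegM => //; apply: qjac_le => //.
    by move=> a b; rewrite subrr mxE.
  move=> a b; move: (hJ a b); move/matrixP/(_ a b): T1; rewrite T2.
  have -> : qjac lg q p *m e = qjac lg q m *m e - 2 *: (contract q e *m e).
    rewrite scalemxAl -mulmxBl /qjac pe contractD; congr (_ *m e).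
    by apply/matrixP => c b'; rewrite !mxLE; lra.
  rewrite mulmxBl !mxLE.
  have -> : m a b = p a b + e a b by rewrite -mxDE -pe.
  lra.
apply: le_trans Yr; rewrite -subr_ge0.
have := nnegM (nneg_tr yn) H 0 0.
rewrite mulmxBr mulmxDr mulmxBr linearB /= trmx_mul trmxK mulmxBl -mulmxA !mxLE.
lra.
Qed.

(** The error splits at p: sensitivity gives m - p <= C t, and K halvings starting from m <= a d
    bound p - x. *)
Lemma perturbed_newton_error : exists2 C, 0 < C &
  forall (cg : 'cV[R]_N) (lg : 'M[R]_N) (t : R) (K : nat),
    nneg cg -> nneg lg -> nneg (cF - cg) -> nneg (lF - lg) -> 0 <= t ->
    (forall i, cF i 0 - cg i 0 <= t ^+ 2) ->
    (forall i k, lF i k - lg i k <= t ^+ 2) ->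
  let x := iter K (qnewton cg lg q) 0 in
  [/\ nneg x, nneg (m - x) & forall i, m i 0 - x i 0 <= C * (t + 2 ^- K)].
Proof.
have [d [_ [d0 hd _ _]]] :=
  irreducible_cone_vectors i0 A0 fixpoint_jacobian_irreducible least_fixpoint_jacobian.
have [C C0 sens] := fixpoint_sensitivity.
have [a a0 ma] := vec_bound m d0.
have [D D0 dD] := vec_bound_cst d.
exists (C + a * D); first by rewrite addr_gt0 ?mulr_gt0.
move=> cg lg t K cg0 lg0 hc hl t0 tc tl x.
have hm : nneg (m - qeval cg lg q m) by exact: perturbed_prefix mE.
have [||p [p0 pE pleast]] := @least_prefixpoint _ _ (qeval cg lg q) _ _ m mn hm.
- by move=> z z0; exact: qeval_ge0.
- by move=> z z' z0 zz'; exact: qeval_mono.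
have pm : nneg (m - p) by exact: pleast.
have had : nneg (a *: d - m) by move=> i j; rewrite ord1 !mxLE subr_ge0.
have [[x0 _ px _] hx] := newton_converges q0 qC cg0 lg0 hc hl m0 mE irr p0 pE pleast d0 hd K (ltW a0) had.
split=> // [|i]; first exact: nneg_trans px pm.
have h1 := sens cg lg p t cg0 lg0 hc hl t0 tc tl p0 pE pm i.
have := hx i 0; rewrite -/x !mxLE => h2.
have h3 : a / 2 ^+ K * d i 0 <= a * D * 2 ^- K.
  by rewrite mulrAC ler_pM2r ?invr_gt0 ?exprn_gt0 // ler_pM2l.
have : 0 <= C * 2 ^- K by rewrite mulr_ge0 ?invr_ge0 ?exprn_ge0 // ltW.
have : 0 <= a * D * t by rewrite !mulr_ge0 // ltW.
rewrite mulrDl !mulrDr; lra.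
Qed.

End Sensitivity.

(** * Quadratic polynomials *)

Section QuadraticPolynomials.
Context {R : realType}.

Definition qpoly n (c : R) (l : 'I_n -> R) (q : 'I_n -> 'I_n -> R) : {mpoly R[n]} :=
  c%:MP + \sum_k l k *: 'X_k + \sum_k \sum_j q k j *: ('X_k * 'X_j).

Lemma sum_delta n (V : lmodType R) (a : 'I_n) (F : 'I_n -> V) :
  \sum_k (k == a)%:R *: F k = F a.
Proof.
rewrite (bigD1 a) //= eqxx scale1r big1 ?addr0 // => k /negPf ->.
by rewrite scale0r.
Qed.

Lemma mderiv_sumr n (I : Type) (r : seq I) (P : pred I) (F : I -> {mpoly R[n]}) b :
  mderiv b (\sum_(i <- r | P i) F i) = \sum_(i <- r | P i) mderiv b (F i).
Proof. exact: (raddf_sum (mderiv b)). Qed.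

Lemma meval_sumr n (I : Type) (r : seq I) (P : pred I) (F : I -> {mpoly R[n]}) v :
  (\sum_(i <- r | P i) F i).@[v] = \sum_(i <- r | P i) (F i).@[v].
Proof. exact: (raddf_sum (meval v)). Qed.

Lemma quadratic_qpoly n (p : {mpoly R[n]}) :
    (msize p <= 3)%N -> (forall m : 'X_{1..n}, 0 <= p@_m) ->
  exists c l (q : 'I_n -> 'I_n -> R), [/\ 0 <= c, forall k, 0 <= l k,
    forall k j, 0 <= q k j, forall k j, q k j = q j k & p = qpoly c l q].
Proof.
pose Q p := exists c l (q : 'I_n -> 'I_n -> R), [/\ 0 <= c, forall k, 0 <= l k,
    forall k j, 0 <= q k j, forall k j, q k j = q j k & p = qpoly c l q].
have QI c l (q : 'I_n -> 'I_n -> R) : 0 <= c -> (forall k, 0 <= l k) ->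
    (forall k j, 0 <= q k j) -> (forall k j, q k j = q j k) -> Q (qpoly c l q).
  by move=> *; exists c, l, q.
have QD p1 p2 : Q p1 -> Q p2 -> Q (p1 + p2).
  move=> [c [l [q [c0 l0 q0 qC ->]]]] [c' [l' [q' [c'0 l'0 q'0 q'C ->]]]].
  have -> : qpoly c l q + qpoly c' l' q' =
      qpoly (c + c') (fun k => l k + l' k) (fun k j => q k j + q' k j).
    rewrite /qpoly mpolyCD addrACA; congr (_ + _).
      rewrite addrACA; congr (_ + _); rewrite -big_split; apply: eq_bigr => k _.
      by rewrite /= scalerDl.
    rewrite -big_split; apply: eq_bigr => k _; rewrite -big_split.
    by apply: eq_bigr => j _; rewrite /= scalerDl.
  by apply: QI => *; rewrite ?addr_ge0 // qC q'C.
have QZ a p1 : 0 <= a -> Q p1 -> Q (a *: p1).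
  move=> a0 [c [l [q [c0 l0 q0 qC ->]]]].
  have -> : a *: qpoly c l q = qpoly (a * c) (fun k => a * l k) (fun k j => a * q k j).
    rewrite /qpoly !scalerDr mpolyCM mul_mpolyC !scaler_sumr; congr (_ + _ + _).
      by apply: eq_bigr => k _; rewrite scalerA.
    apply: eq_bigr => k _; rewrite scaler_sumr.
    by apply: eq_bigr => j _; rewrite scalerA.
  by apply: QI => *; rewrite ?mulr_ge0 // qC.
have z0 c : qpoly c (fun=> 0) (fun _ _ => 0) = c%:MP :> {mpoly R[n]}.
  rewrite /qpoly ![\sum_k _]big1 ?addr0 // => k _; first by rewrite scale0r.
  by rewrite big1 // => j _; rewrite scale0r.
have Q0 : Q 0 by rewrite -mpolyC0 -z0; exact: QI.
have QX (m : 'X_{1..n}) : (mdeg m < 3)%N -> Q 'X_[m].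
  have QU a : Q 'X_a.
    have -> : 'X_a = qpoly 0 (fun k => (k == a)%:R) (fun _ _ => 0).
      rewrite /qpoly mpolyC0 add0r sum_delta big1 ?addr0 // => k _.
      by rewrite big1 // => j _; rewrite scale0r.
    exact: QI.
  case E : (mdeg m) => [|[|[|//]]] _.
  - move/eqP: E; rewrite mdeg_eq0 => /eqP ->; rewrite mpolyX0.
    by rewrite -mpolyC1 -z0; exact: QI.
  - by move/eqP/mdeg1P: E => [i /eqP ->].
  have [a ma] : exists a, (0 < m a)%N.
    apply/existsP; apply: contra_eqT E => /existsPn h.
    by rewrite mdegE big1 // => i _; apply/eqP; rewrite -leqn0 leqNgt h.
  have Um : (U_(a) <= m)%MM.
    by apply/mnm_lepP => i; rewrite mnm1E; case: eqP => [<-|].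
  have mE := submK Um.
  have /eqP/mdeg1P[b /eqP bE] : mdeg (m - U_(a))%MM = 1%N.
    by apply: (@addIn 1%N); rewrite -{1}(mdeg1 a) -mdegD mE E.
  rewrite -mE bE mpolyXD.
  (* Half of the coefficient goes to each ordering; for a = b the two halves fall on the same entry
     and add up to 1. *)
  pose q k j : R := 2^-1 * ((k == a)%:R * (j == b)%:R + (k == b)%:R * (j == a)%:R).
  suff -> : 'X_b * 'X_a = qpoly 0 (fun=> 0) q.
    apply: QI => // k j; rewrite /q.
      by rewrite mulr_ge0 ?invr_ge0 // addr_ge0 // mulr_ge0.
    by congr (_ * _); rewrite addrC; congr (_ + _); exact: mulrC.
  rewrite /qpoly mpolyC0 [X in _ + X + _]big1 ?add0r; last by move=> k _; rewrite scale0r.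
  transitivity (2^-1 *: ('X_a * 'X_b + 'X_b * 'X_a : {mpoly R[n]})).
    by rewrite [X in X + _]mulrC -mulr2n -scaler_nat scalerA mulVf ?scale1r ?pnatr_eq0.
  rewrite -[X in X + _](sum_delta a (fun k => 'X_k * 'X_b)).
  rewrite -[X in _ + X](sum_delta b (fun k => 'X_k * 'X_a)).
  rewrite -big_split scaler_sumr; apply: eq_bigr => k _ /=.
  rewrite -(sum_delta b (fun j => 'X_k * 'X_j)) -(sum_delta a (fun j => 'X_k * 'X_j)).
  rewrite !scaler_sumr -big_split /= scaler_sumr; apply: eq_bigr => j _.
  by rewrite !scalerA -scalerDl scalerA.
move=> sz p0; rewrite -/(Q p) [p]mpolyE.
rewrite big_seq; apply: big_ind => // m mp.
by apply: QZ => //; apply: QX; apply: leq_trans sz; exact: msize_mdeg_lt.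
Qed.

Lemma meval_qpoly n c l q (v : 'I_n -> R) : (qpoly c l q).@[v] =
  c + \sum_k l k * v k + \sum_k \sum_j q k j * (v k * v j).
Proof.
rewrite /qpoly !mevalD mevalC !meval_sumr; congr (_ + _ + _).
  by apply: eq_bigr => k _; rewrite mevalZ mevalXU.
apply: eq_bigr => k _; rewrite meval_sumr; apply: eq_bigr => j _.
by rewrite mevalZ mevalM !mevalXU.
Qed.

Lemma comp_qpoly n N c l q (s : n.-tuple {mpoly R[N]}) : qpoly c l q \mPo s =
  c%:MP + \sum_k l k *: tnth s k + \sum_k \sum_j q k j *: (tnth s k * tnth s j).
Proof.
rewrite /qpoly !comp_mpolyD comp_mpolyC !raddf_sum /=; congr (_ + _ + _).
  by apply: eq_bigr => k _; rewrite comp_mpolyZ comp_mpolyXU -tnth_nth.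
apply: eq_bigr => k _; rewrite raddf_sum; apply: eq_bigr => j _.
by rewrite /= comp_mpolyZ rmorphM /= !comp_mpolyXU -!tnth_nth.
Qed.

Lemma comp_qpolyA n N N' c l q (s : n.-tuple {mpoly R[N]}) (u : N.-tuple {mpoly R[N']}) :
  (qpoly c l q \mPo s) \mPo u = qpoly c l q \mPo [tuple tnth s k \mPo u | k < n].
Proof.
rewrite !comp_qpoly !comp_mpolyD comp_mpolyC !raddf_sum /=; congr (_ + _ + _).
  by apply: eq_bigr => k _; rewrite comp_mpolyZ tnth_mktuple.
apply: eq_bigr => k _; rewrite raddf_sum; apply: eq_bigr => j _.
by rewrite /= comp_mpolyZ rmorphM /= !tnth_mktuple.
Qed.

(** The chain rule; the symmetry of q merges the two terms of the product rule into the factor 2. *)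
Lemma meval_mderiv_comp_qpoly n N c l q (s : n.-tuple {mpoly R[N]}) (v : 'I_N -> R) b :
  (forall k j, q k j = q j k) ->
  (mderiv b (qpoly c l q \mPo s)).@[v] =
  \sum_k (l k + 2 * \sum_j q k j * (tnth s j).@[v]) * (mderiv b (tnth s k)).@[v].
Proof.
move=> qC; rewrite comp_qpoly !mderivD mderivC add0r mevalD !mderiv_sumr !meval_sumr.
under [RHS]eq_bigr do rewrite mulrDl.
rewrite big_split /=; congr (_ + _).
  by apply: eq_bigr => k _; rewrite mderivZ mevalZ.
pose H k j := q k j * (tnth s j).@[v] * (mderiv b (tnth s k)).@[v].
transitivity (\sum_k \sum_j (H k j + H j k)).
  apply: eq_bigr => k _; rewrite mderiv_sumr meval_sumr; apply: eq_bigr => j _.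
  by rewrite mderivZ mevalZ mderivM mevalD !mevalM /H (qC j k); ring.
rewrite (eq_bigr (fun k => \sum_j H k j + \sum_j H j k)); last first.
  by move=> k _; rewrite big_split.
rewrite big_split /= [X in _ + X]exchange_big /= -[LHS]mulr2n -[LHS]mulr_natl mulr_sumr.
by apply: eq_bigr => k _; rewrite -mulrA mulr_suml.
Qed.

Section System.
Context {n : nat} (f : psys R n).
Context (c : 'cV[R]_n) (l : 'M[R]_n) (q : 'I_n -> 'I_n -> 'I_n -> R).
Hypothesis qC : forall i k j, q i k j = q i j k.
Hypothesis fE : forall i, f i = qpoly (c i 0) (l i) (q i).

Lemma meval_qsys i (v : 'I_n -> R) : (f i).@[v] = qeval c l q (\col_k v k) i 0.
Proof.
rewrite fE meval_qpoly /qeval !mxLE !mxE; congr (_ + _ + _).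
  by apply: eq_bigr => k _; rewrite mxE.
apply: eq_bigr => k _; rewrite !mxE mulr_suml; apply: eq_bigr => j _.
by rewrite mxE; ring.
Qed.

Lemma eval_sys_qeval X : eval_sys f X = qeval c l q X.
Proof.
apply/matrixP => i j; rewrite mxE meval_qsys ord1.
by congr (qeval _ _ _ _ _ _); apply/matrixP => a b; rewrite mxE ord1.
Qed.

Hypothesis l0 : nneg l.
Hypothesis q0 : forall i k j, 0 <= q i k j.

Lemma ddepends_qdep i k : ddepends f i k = qdep l q i k.
Proof.
have E (v : 'I_n -> R) : (mderiv k (f i)).@[v] = l i k + 2 * \sum_j q i k j * v j.
  rewrite -(comp_mpoly_id (f i)) fE meval_mderiv_comp_qpoly //.
  transitivity (\sum_a (a == k)%:R *: ((l i a + 2 * (\sum_j q i a j * v j)) : R^o)).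
    apply: eq_bigr => a _; rewrite tnth_mktuple mderivX mnm1E.
    rewrite [_ *: _ in RHS]/(_ *: _) mulrC; congr (_ * _); last first.
      congr (_ + _ * _); apply: eq_bigr => j _; by rewrite tnth_mktuple mevalXU.
    have [->|_] := eqVneq a k; last by rewrite scale0r meval0.
    by rewrite scale1r -{1}[U_(k)%MM]add0m addmK mpolyX0 meval1.
  by rewrite sum_delta.
have [h|/norP[nl nq]] := boolP (qdep l q i k).
  (* At the all-ones vector the derivative is a sum of nonnegative coefficients, so nothing
     cancels. *)
  apply/eqP => Z; move: (E (fun=> 1)); rewrite Z meval0 => /eqP; apply/negP.
  rewrite eq_sym gt_eqF //; case/orP: h => [lik|/existsP[j qj]].
    rewrite ltr_pwDl // mulr_ge0 // sumr_ge0 // => a _; by rewrite mulr1.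
  rewrite ltr_wpDl // mulr_gt0 // (bigD1 j) //= mulr1 ltr_pwDl // sumr_ge0 // => a _.
  by rewrite mulr1.
apply/negbTE/negPn/eqP.
have qZ j : q i k j = 0.
  by apply/eqP; rewrite eq_le q0 andbT leNgt; move/existsPn: nq.
rewrite fE /qpoly !mderivD mderivC add0r !mderiv_sumr.
rewrite big1 ?add0r => [|a _]; last first.
  rewrite mderivZ mderivX mnm1E.
  have [->|_] := eqVneq a k; last by rewrite scale0r scaler0.
  have -> : l i k = 0 by apply/eqP; rewrite eq_le l0 andbT leNgt.
  by rewrite scale0r.
rewrite big1 // => a _; rewrite mderiv_sumr big1 // => j _.
rewrite mderivZ mderivM !mderivX !mnm1E.
have [->|_] := eqVneq a k; first by rewrite qZ scale0r.
have [->|_] := eqVneq j k; first by rewrite qC qZ scale0r.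
by rewrite !scale0r mul0r mulr0 addr0 scaler0.
Qed.

End System.
End QuadraticPolynomials.

(** * Strongly connected components *)

Section Components.
Context {R : realType} {n : nat} (f : psys R n).
Let e := ddepends f.

Definition scc i : {set 'I_n} := [set k | connect e i k && connect e k i].

Lemma mem_scc i : i \in scc i.
Proof. by rewrite inE connect0. Qed.

Lemma scc_sccs i : scc i \in sccs f.
Proof.
rewrite inE; apply/maxsetP; split.
  apply/forallP => a; apply/implyP; rewrite inE => /andP[_ ai].
  apply/forallP => b; apply/implyP; rewrite inE => /andP[ib _].
  exact: connect_trans ai ib.
move=> B /forallP hB iB; apply/eqP; rewrite eqEsubset iB andbT.
have Bi : i \in B by rewrite (subsetP iB) // mem_scc.
apply/subsetP => k Bk; rewrite inE.
have := hB i; rewrite Bi /= => /forallP/(_ k); rewrite Bk /= => ->.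
by have := hB k; rewrite Bk /= => /forallP/(_ i); rewrite Bi.
Qed.

Lemma sccs_scc S i : S \in sccs f -> i \in S -> S = scc i.
Proof.
rewrite inE => /maxsetP[/forallP hS maxS] iS; symmetry; apply: maxS.
  by have := scc_sccs i; rewrite inE => /maxsetP[].
have hS' a b : a \in S -> b \in S -> connect e a b.
  by move=> aS bS; have := hS a; rewrite aS /= => /forallP/(_ b); rewrite bS.
by apply/subsetP => k kS; rewrite inE !hS'.
Qed.

Lemma scc_eq i k : k \in scc i -> scc k = scc i.
Proof. by move=> ki; rewrite -(sccs_scc (scc_sccs i) ki). Qed.

Lemma scc_edgeP S T : scc_edge f S T -> exists i k,
  [/\ S = scc i, T = scc k, scc i != scc k & connect e k i].
Proof.
case/and4P => hS hT ST /existsP[k /andP[kT /existsP[i /andP[iS ki]]]].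
have Si := sccs_scc hS iS; have Tk := sccs_scc hT kT.
by exists i, k; split=> //; rewrite -?Si -?Tk //; exact: connect1.
Qed.

Lemma scc_edge_ddepends i k : ddepends f i k -> k \notin scc i ->
  scc_edge f (scc k) (scc i).
Proof.
move=> ik ki; apply/and4P; split; try exact: scc_sccs.
  by apply: contraNneq ki => <-; exact: mem_scc.
apply/existsP; exists i; rewrite mem_scc; apply/existsP; exists k.
by rewrite mem_scc.
Qed.

(** Edges run against [ddepends]: a component later on the path depends on the earlier ones. *)
Lemma scc_path_reach i p S : path (scc_edge f) (scc i) p -> S \in p ->
  exists k, S = scc k /\ connect e k i.
Proof.
elim: p i => [|T p IH] i //= /andP[/scc_edgeP[a [b [ia Tb _ ba]]] Tp].
have bi : connect e b i.
  apply: connect_trans ba _; have := mem_scc i.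
  by rewrite ia inE => /andP[].
rewrite inE => /predU1P[->|Sp]; first by exists b.
rewrite Tb in Tp; have [k [Sk kb]] := IH b Tp Sp.
by exists k; split=> //; exact: connect_trans kb bi.
Qed.

Lemma scc_path_uniq i p : path (scc_edge f) (scc i) p -> uniq (scc i :: p).
Proof.
elim: p i => [|T p IH] i //= /andP[/scc_edgeP[a [b [ia Tb ab ba]]] Tp].
rewrite Tb in Tp *; have /= /andP[-> ->] := IH b Tp; rewrite !andbT inE negb_or.
rewrite ia ab; apply/negP => ip.
have [k [ik kb]] := scc_path_reach Tp ip.
case/negP: ab; apply/eqP/esym/scc_eq; rewrite inE ba andbT.
by apply: connect_trans kb; have := mem_scc k; rewrite -ik inE => /andP[].
Qed.

Lemma scc_path_size i p : path (scc_edge f) (scc i) p -> (size p < n)%N.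
Proof.
move=> ip; have := @uniq_leq_size _ (scc i :: p) [seq scc k | k <- enum 'I_n].
rewrite size_map size_enum_ord; apply; first exact: scc_path_uniq.
move=> S; rewrite inE => /predU1P[->|Sp].
  by apply/map_f; rewrite mem_enum.
have [k [-> _]] := scc_path_reach ip Sp.
by apply/map_f; rewrite mem_enum.
Qed.

(** A longest path ends in a top component. Hence the maximum in [depth] ranges over a nonempty set
    and is attained, rather than being the default 0. *)
Lemma scc_path_top i : exists2 p, path (scc_edge f) (scc i) p &
  top_scc f (last (scc i) p).
Proof.
pose P m := [exists p : m.-tuple {set 'I_n}, path (scc_edge f) (scc i) p].
have P0 : exists m, P m by exists 0%N; apply/existsP; exists [tuple].
have Pb m : P m -> (m <= n)%N.
  by case/existsP => p /scc_path_size; rewrite size_tuple => /ltnW.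
case: (ex_maxnP P0 Pb) => m /existsP[p ip] mmax; exists p => //.
have lastP : last (scc i) p \in sccs f.
  have := mem_last (scc i) p; rewrite inE => /predU1P[->|lp]; first exact: scc_sccs.
  by have [k [-> _]] := scc_path_reach ip lp; exact: scc_sccs.
rewrite /top_scc lastP; apply/forallP => T; apply/negP => lT.
have : P m.+1.
  apply/existsP; exists [tuple of rcons p T]; by rewrite /= rcons_path ip.
by move/mmax; rewrite ltnn.
Qed.

(** Prepend [scc i] to a path attaining the depth of [scc k]; by [scc_path_size] the longer path is
    still within the range of the bounded maximum. *)
Lemma depth_edge i k : scc_edge f (scc i) (scc k) -> (depth f (scc k) < depth f (scc i))%N.
Proof.
move=> ik; have [p kp tp] := scc_path_top k.
pose P (S : {set 'I_n}) (m : 'I_n.+1) := [exists p : m.-tuple {set 'I_n},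
  path (scc_edge f) S p && top_scc f (last S p)].
have sp : (size p < n.+1)%N by rewrite ltnS ltnW // (scc_path_size kp).
have nonempty : (0 < #|P (scc k)|)%N.
  apply/card_gt0P; exists (Ordinal sp); apply/existsP; exists (in_tuple p).
  by rewrite kp tp.
have [m /existsP[s /andP[ks ts]] dE] := eq_bigmax_cond (fun m : 'I_n.+1 => m : nat) nonempty.
rewrite /depth [X in (X < _)%N]dE.
have ip : path (scc_edge f) (scc i) (scc k :: s) by rewrite /= ik.
have sm : (m.+1 < n.+1)%N by have := scc_path_size ip; rewrite /= size_tuple ltnS => /ltnW.
apply: (@leq_bigmax_cond _ (P (scc i)) (fun m : 'I_n.+1 => m : nat) (Ordinal sm)).
by apply/existsP; exists [tuple of scc k :: s]; rewrite ip.
Qed.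

Definition vdepth i := depth f (scc i).

Lemma vdepth_sccs S i : S \in sccs f -> i \in S -> depth f S = vdepth i.
Proof. by move=> hS iS; rewrite (sccs_scc hS iS). Qed.

Lemma vdepth_ddepends i k : ddepends f i k -> k \in scc i \/ (vdepth i < vdepth k)%N.
Proof.
move=> ik; have [ki|ki] := boolP (k \in scc i); first by left.
by right; apply: depth_edge; exact: scc_edge_ddepends.
Qed.

Lemma vdepth_height i : (vdepth i <= height f)%N.
Proof. exact: (leq_bigmax_cond _ (scc_sccs i)). Qed.

Lemma exists_shallow_scc t i :
  [exists T in sccs f, (i \in T) && (depth f T < t)%N] = (vdepth i < t)%N.
Proof.
apply/existsP/idP => [[T /and3P[hT iT]]|it].
  by rewrite (vdepth_sccs hT iT).
by exists (scc i); rewrite scc_sccs mem_scc.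
Qed.

Lemma sccs_disjoint S T k : S \in sccs f -> T \in sccs f -> k \in S -> k \in T -> S = T.
Proof. by move=> hS hT kS kT; rewrite (sccs_scc hS kS) (sccs_scc hT kT). Qed.

(* Every path between members of S stays in S. *)
Lemma scc_connect (S : {set 'I_n}) (a b : 'I_#|S|) : S \in sccs f ->
  connect (fun x y => ddepends f (enum_val x) (enum_val y)) a b.
Proof.
move=> hS; have hSE := sccs_scc hS (enum_valP b).
have /connectP[p] : connect e (enum_val a) (enum_val b).
  by have := enum_valP a; rewrite {2}hSE inE => /andP[].
elim: p a => [|k p IH] a /= => [_ /enum_val_inj ->|/andP[ak kp] bE]; first exact: connect0.
have kS : k \in S.
  rewrite hSE inE; apply/andP; split.
    have := enum_valP a; rewrite {2}hSE inE => /andP[ba _].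
    exact: connect_trans ba (connect1 ak).
  by apply/connectP; exists p.
apply: (@connect_trans _ _ (enum_rank_in kS k)).
  by apply: connect1; rewrite enum_rankK_in.
by apply: IH; rewrite enum_rankK_in.
Qed.

End Components.

(** * Restriction of a quadratic system to a set of variables *)

Section Restriction.
Context {R : realType} {n : nat}.
Context (c : 'cV[R]_n) (l : 'M[R]_n) (q : 'I_n -> 'I_n -> 'I_n -> R).
Hypothesis qC : forall i k j, q i k j = q i j k.
Context (S : {set 'I_n}).

Definition embed (Z : 'cV[R]_#|S|) : 'cV[R]_n := \col_k extend (fun a => Z a 0) k.

Lemma extend_enum_val (V : nmodType) (x : 'I_#|S| -> V) a :
  extend x (enum_val a) = x a.
Proof.
rewrite /extend (big_pred1 a) // => b; rewrite /= (inj_eq enum_val_inj).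
by rewrite eq_sym.
Qed.

Lemma extend_out (V : nmodType) (x : 'I_#|S| -> V) k : k \notin S -> extend x k = 0.
Proof.
move=> kS; rewrite /extend big_pred0 // => a; apply/negbTE.
by apply: contraNneq kS => <-; exact: enum_valP.
Qed.

Lemma sum_extend (F : 'I_n -> R) (x : 'I_#|S| -> R) :
  \sum_k F k * extend x k = \sum_a F (enum_val a) * x a.
Proof.
rewrite [RHS](partition_big (@enum_val _ S) xpredT) //=; apply: eq_bigr => k _.
by rewrite mulr_sumr; apply: eq_bigr => a /eqP ->.
Qed.

(** Moving only the variables of S away from w is a Taylor expansion at w: the value gives the
    constant part, the Jacobian the linear part, and the quadratic part does not depend on w. *)
Definition restr_cst (w : 'cV[R]_n) : 'cV[R]_#|S| :=
  \col_a qeval c l q w (enum_val a) 0.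

Definition restr_lin (w : 'cV[R]_n) : 'M[R]_#|S| :=
  \matrix_(a, b) qjac l q w (enum_val a) (enum_val b).

Definition restr_quad (a b b' : 'I_#|S|) := q (enum_val a) (enum_val b) (enum_val b').

Lemma contract_restr Z a b :
  contract q (embed Z) (enum_val a) (enum_val b) = contract restr_quad Z a b.
Proof.
rewrite !mxE -[RHS](sum_extend (q (enum_val a) (enum_val b)) (fun b => Z b 0)).
by apply: eq_bigr => j _; rewrite mxE.
Qed.

Lemma mulmx_embed (A : 'M[R]_n) Z i :
  (A *m embed Z) i 0 = \sum_b A i (enum_val b) * Z b 0.
Proof.
rewrite mxE -(sum_extend (A i) (fun b => Z b 0)).
by apply: eq_bigr => k _; rewrite [embed _ _ _]mxE.
Qed.

Lemma qeval_restr w Z a : qeval c l q (w + embed Z) (enum_val a) 0 =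
  qeval (restr_cst w) (restr_lin w) restr_quad Z a 0.
Proof.
have -> : qeval (restr_cst w) (restr_lin w) restr_quad Z a 0 =
    qeval c l q w (enum_val a) 0 + (restr_lin w *m Z) a 0 +
    (contract restr_quad Z *m Z) a 0.
  by rewrite qevalE [restr_cst _ _ _]mxE.
rewrite qeval_taylor //; move: (qeval c l q w) => u; rewrite !mxDE; congr (_ + _ + _).
- by rewrite mulmx_embed [RHS]mxE; apply: eq_bigr => b _; rewrite [restr_lin _ _ _]mxE.
- by rewrite mulmx_embed [RHS]mxE; apply: eq_bigr => b _; rewrite contract_restr.
Qed.

Lemma qjac_restr w Z a b : qjac l q (w + embed Z) (enum_val a) (enum_val b) =
  qjac (restr_lin w) restr_quad Z a b.
Proof.
rewrite /qjac contractD !mxLE contract_restr [restr_lin _ _ _]mxE /qjac !mxLE; ring.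
Qed.

Context (f : psys R n).
Hypothesis fE : forall i, f i = qpoly (c i 0) (l i) (q i).

(** Successive substitutions collapse to one simultaneous substitution into [f], which is the form
    kept by the invariants. *)
Definition fix_vars (P : {set 'I_n}) (nu : 'cV[R]_n) (i : 'I_n) : {mpoly R[n]} :=
  f i \mPo [tuple if k \in P then (nu k 0)%:MP else 'X_k | k < n].

(** The zeros match [subsys], which sends every remaining variable outside S to 0. *)
Definition mask (P : {set 'I_n}) (nu : 'cV[R]_n) : 'cV[R]_n :=
  \col_k if k \in P then nu k 0 else 0.

Context (g : psys R n) (P : {set 'I_n}) (nu : 'cV[R]_n).
Hypothesis PS : [disjoint P & S].
Hypothesis gE : forall i, i \in S -> g i = fix_vars P nu i.

Let s := [tuple if k \in P then (nu k 0)%:MP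
  else extend (fun b : 'I_#|S| => 'X_b : {mpoly R[#|S|]}) k | k < n].

Lemma subsys_qpoly (a : 'I_#|S|) : subsys g a =
  qpoly (c (enum_val a) 0) (l (enum_val a)) (q (enum_val a)) \mPo s.
Proof.
rewrite /subsys gE ?enum_valP // /fix_vars fE comp_qpolyA; congr (_ \mPo _).
apply: eq_from_tnth => k; rewrite !tnth_mktuple; case: ifP => _.
  by rewrite comp_mpolyC.
by rewrite comp_mpolyXU -tnth_nth tnth_mktuple.
Qed.

Lemma subsys_point (Z : 'cV[R]_#|S|) k :
  (tnth s k).@[fun b => Z b 0] = (mask P nu + embed Z) k 0.
Proof.
rewrite tnth_mktuple !mxE; case: ifP => kP.
  by rewrite mevalC extend_out ?addr0 // (disjointFr PS).
rewrite add0r /extend meval_sumr; apply: eq_bigr => b _.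
by rewrite mevalXU.
Qed.

Lemma eval_subsys Z : eval_sys (@subsys _ _ g S) Z =
  qeval (restr_cst (mask P nu)) (restr_lin (mask P nu)) restr_quad Z.
Proof.
apply/matrixP => a b; rewrite ord1 mxE subsys_qpoly comp_mpoly_meval -fE.
rewrite (meval_qsys fE) -qeval_restr; congr (qeval _ _ _ _ _ _).
by apply/matrixP => k j; rewrite ord1 [LHS]mxE subsys_point.
Qed.

Lemma jacobian_subsys Z :
  jacobian (@subsys _ _ g S) Z = qjac (restr_lin (mask P nu)) restr_quad Z.
Proof.
apply/matrixP => a b; rewrite mxE subsys_qpoly meval_mderiv_comp_qpoly //.
rewrite -qjac_restr.
transitivity (\sum_k qjac l q (mask P nu + embed Z) (enum_val a) k *
    extend (fun b' => (b' == b)%:R) k).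
  apply: eq_bigr => k _; congr (_ * _).
    rewrite /qjac !mxLE [contract _ _ _ _]mxE; congr (_ + _ * _).
    by apply: eq_bigr => j _; rewrite subsys_point.
  rewrite tnth_mktuple; case: ifP => kP.
    by rewrite mderivC meval0 extend_out // (disjointFr PS).
  rewrite /extend mderiv_sumr meval_sumr; apply: eq_bigr => b' _.
  rewrite mderivX mnm1E; have [->|_] := eqVneq b' b; last by rewrite scale0r meval0.
  by rewrite scale1r -{1}[U_(b)%MM]add0m addmK mpolyX0 meval1.
rewrite sum_extend (bigD1 b) //= eqxx mulr1 big1 ?addr0 // => b' /negPf ->.
by rewrite mulr0.
Qed.

Lemma newton_subsys : newton (@subsys _ _ g S) =1
  qnewton (restr_cst (mask P nu)) (restr_lin (mask P nu)) restr_quad.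
Proof. by move=> Z; rewrite /newton /qnewton eval_subsys jacobian_subsys. Qed.

End Restriction.

Lemma qeval_local (R : realType) n c l (q : 'I_n -> 'I_n -> 'I_n -> R) (x y : 'cV[R]_n) i :
    (forall i k j, 0 <= q i k j) -> (forall i k j, q i k j = q i j k) -> nneg l ->
    (forall k, qdep l q i k -> x k 0 = y k 0) ->
  qeval c l q x i 0 = qeval c l q y i 0.
Proof.
move=> q0 qC l0 xy; rewrite !qevalE; congr (_ + _ + _).
  rewrite !mxE; apply: eq_bigr => k _; have [lk|lk] := ltP 0 (l i k).
    by rewrite xy // /qdep lk.
  by have -> : l i k = 0; [apply/eqP; rewrite eq_le lk l0|rewrite !mul0r].
rewrite !mxE; apply: eq_bigr => k _; rewrite !mxE !mulr_suml; apply: eq_bigr => j _.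
have [qk|qk] := ltP 0 (q i k j); last first.
  by have -> : q i k j = 0; [apply/eqP; rewrite eq_le qk q0|rewrite !mul0r].
have -> : x j 0 = y j 0.
  by apply: xy; apply/orP; right; apply/existsP; exists k; rewrite qC.
by have -> : x k 0 = y k 0; [apply: xy; apply/orP; right; apply/existsP; exists j|].
Qed.

(** * Error propagation through one component *)

Section ComponentStep.
Context {R : realType} {n : nat} (f : psys R n).
Context (c : 'cV[R]_n) (l : 'M[R]_n) (q : 'I_n -> 'I_n -> 'I_n -> R).
Hypothesis c0 : nneg c.
Hypothesis l0 : nneg l.
Hypothesis q0 : forall i k j, 0 <= q i k j.
Hypothesis qC : forall i k j, q i k j = q i j k.
Hypothesis fE : forall i, f i = qpoly (c i 0) (l i) (q i).

(** [lfp] is by definition least among fixed points. Identifying it with the infimum of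
    [least_prefixpoint] makes it least among prefixed points, which is what the comparisons below
    use. *)
Lemma lfp_least_prefixpoint : feasible f ->
  [/\ nneg (lfp f), qeval c l q (lfp f) = lfp f &
    forall z, nneg z -> nneg (z - qeval c l q z) -> nneg (z - lfp f)].
Proof.
move=> [X [X0 XE]]; rewrite (eval_sys_qeval fE) in XE.
have Xn : nneg X by move=> i j; rewrite ord1.
have [|||p [p0 pE pleast]] := @least_prefixpoint _ _ (qeval c l q) _ _ X Xn.
- by move=> z z0; exact: qeval_ge0.
- by move=> z z' z0 zz'; exact: qeval_mono.
- by rewrite XE subrr => i j; rewrite mxE.
have plfp : is_lfp f p.
  split; first by split=> //; rewrite (eval_sys_qeval fE).
  move=> Y [Y0 YE] k; rewrite (eval_sys_qeval fE) in YE.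
  have : nneg (Y - p).
    by apply: pleast => [i j|]; rewrite ?ord1 // YE subrr => i j; rewrite mxE.
  by move=> /(_ k 0); rewrite !mxLE subr_ge0.
suff -> : lfp f = p by split.
have [[Y0 YE] Yleast] : is_lfp f (lfp f) by apply: classical_sets.xgetPex; exists p.
apply/matrixP => i j; rewrite ord1; apply/eqP; rewrite eq_le.
rewrite (Yleast p plfp.1) /=; exact: plfp.2 (conj Y0 YE) i.
Qed.

Context (mu : 'cV[R]_n).
Hypothesis muE : qeval c l q mu = mu.
Hypothesis mu_least : forall z, nneg z -> nneg (z - qeval c l q z) -> nneg (z - mu).

Lemma fixpoint_gt0 : nneg mu -> clean f -> forall i, 0 < mu i 0.
Proof.
move=> mun cl i; have [k ki] := cl i; apply: (lt_le_trans ki).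
suff [_ /(_ i 0)] : nneg (kleene f k) /\ nneg (mu - kleene f k) by rewrite !mxLE subr_ge0.
rewrite /kleene; elim: k {ki} => [|k [IH0 IH]] /=.
  by rewrite subr0; split=> // a b; rewrite mxE.
rewrite (eval_sys_qeval fE); split; first exact: qeval_ge0.
by rewrite -{1}muE; exact: qeval_mono.
Qed.

Hypothesis mu_gt0 : forall i, 0 < mu i 0.

Definition deeper t : {set 'I_n} := [set k | (t < vdepth f k)%N].

Let mun : nneg mu. Proof. by move=> i j; rewrite ord1 ltW. Qed.

Let ddE i k : ddepends f i k = qdep l q i k.
Proof. by rewrite (ddepends_qdep qC fE l0 q0). Qed.

Section OneComponent.
Context (S : {set 'I_n}) (t : nat).
Hypothesis hS : S \in sccs f.
Hypothesis St : depth f S = t.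

Let disj : [disjoint deeper t & S].
Proof.
rewrite disjoint_subset; apply/subsetP => k; rewrite !inE => tk.
by apply/negP => kS; move: tk; rewrite -(vdepth_sccs hS kS) St ltnn.
Qed.

Let dep_cases i k : i \in S -> qdep l q i k -> (k \in S) || (k \in deeper t).
Proof.
rewrite -ddE => iS /vdepth_ddepends; rewrite -(sccs_scc hS iS) inE.
by rewrite -(vdepth_sccs hS iS) St => -[->|->] //; rewrite orbT.
Qed.

Let wF := mask (deeper t) mu.
Let m : 'cV[R]_#|S| := \col_a mu (enum_val a) 0.
Let cF := restr_cst c l q S wF.
Let lF := restr_lin l q S wF.
Let qS := @restr_quad R n q S.

Let wF0 : nneg wF.
Proof. by move=> k j; rewrite mxE; case: ifP. Qed.

Let eval_component (z : 'cV[R]_n) (Z : 'cV[R]_#|S|) a :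
    (forall b, z (enum_val b) 0 = Z b 0) -> (forall k, k \in deeper t -> z k 0 = mu k 0) ->
  qeval cF lF qS Z a 0 = qeval c l q z (enum_val a) 0.
Proof.
move=> zS zD; rewrite -qeval_restr //; apply: qeval_local => // k /dep_cases.
move=> /(_ (enum_valP a)); rewrite !mxE.
have [kD _|kD] := boolP (k \in deeper t).
  by rewrite extend_out ?addr0 ?zD // (disjointFr disj).
rewrite orbF => kS; rewrite add0r -(enum_rankK_in kS kS) extend_enum_val.
by rewrite -zS.
Qed.

Let component_fix : qeval cF lF qS m = m.
Proof.
apply/matrixP => a j; rewrite ord1 (eval_component (z := mu)) //.
  by rewrite muE mxE.
by move=> b; rewrite mxE.
Qed.

(** Glue Z on S to [mu] elsewhere. As Z <= m, the glued vector lies below [mu], so by monotonicity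
    it is prefixed outside S too, and leastness of [mu] applies. *)
Let component_least Z : nneg Z -> nneg (m - Z) -> nneg (Z - qeval cF lF qS Z) -> Z = m.
Proof.
move=> Z0 Zm hZ; pose z := \col_k if k \in S then embed Z k 0 else mu k 0.
have zS b : z (enum_val b) 0 = Z b 0.
  by rewrite !mxE enum_valP extend_enum_val.
have zNS k : k \notin S -> z k 0 = mu k 0 by rewrite mxE => /negPf ->.
have mz : nneg (mu - z).
  move=> k j; rewrite ord1 !mxLE subr_ge0; have [kS|kS] := boolP (k \in S).
    rewrite -(enum_rankK_in kS kS) zS; have := Zm (enum_rank_in kS k) 0.
    by rewrite !mxLE [m _ _]mxE subr_ge0.
  by rewrite zNS.
have zn : nneg z.
  move=> k j; rewrite ord1; have [kS|kS] := boolP (k \in S).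
    by rewrite -(enum_rankK_in kS kS) zS.
  by rewrite zNS.
have : nneg (z - mu).
  apply: mu_least => // k j; rewrite ord1 mxDE mxNE subr_ge0.
  have [kS|kS] := boolP (k \in S).
    rewrite -(enum_rankK_in kS kS) -(eval_component _ zS).
      by rewrite zS; have := hZ (enum_rank_in kS k) 0; rewrite mxDE mxNE subr_ge0.
    by move=> h hD; rewrite zNS // (disjointFr disj hD).
  rewrite zNS // -{1}muE; have := qeval_mono q0 qC c l0 zn mz k 0.
  by rewrite mxDE mxNE subr_ge0.
move=> zm; apply/matrixP => a j; rewrite ord1 -zS [RHS]mxE.
apply/eqP; rewrite eq_le; move: (mz (enum_val a) 0) (zm (enum_val a) 0).
by rewrite !mxLE !subr_ge0 => -> ->.
Qed.

Let component_irr a b : connect (qdep lF qS) a b.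
Proof.
apply: connect_sub (scc_connect a b hS) => {}a {}b /=; rewrite ddE => ab.
apply: connect1; rewrite /qdep [lF _ _]mxE /qjac !mxLE.
have K0 := contract_ge0 q0 wF0 (enum_val a) (enum_val b).
have L0 := l0 (enum_val a) (enum_val b).
case/orP: ab => [lab|/existsP[j qj]].
  by apply/orP; left; rewrite ltr_pwDl // mulr_ge0.
have : (j \in S) || (j \in deeper t).
  apply: (dep_cases (enum_valP a)); apply/orP; right; apply/existsP.
  by exists (enum_val b); rewrite qC.
(* A product with a deeper variable j becomes a linear term of the component, with positive
   coefficient because [mu] is positive at j. *)
case/orP => [jS|jD].
  apply/orP; right; apply/existsP; exists (enum_rank_in jS j).
  by rewrite /qS /restr_quad enum_rankK_in.
apply/orP; left; rewrite ltr_wpDl // mulr_gt0 // mxE (bigD1 j) //=.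
rewrite ltr_pwDl // ?mulr_gt0 // ?[wF _ _]mxE ?jD // sumr_ge0 // => h _.
exact: mulr_ge0.
Qed.

Lemma component_newton_error (C1 : R) : 0 <= C1 -> exists2 C, 0 < C &
  forall (K : nat) (g : psys R n) (nu : 'cV[R]_n),
    (forall i, i \in S -> g i = fix_vars f (deeper t) nu i) ->
    (forall k, k \in deeper t ->
       0 <= nu k 0 <= mu k 0 /\ mu k 0 - nu k 0 <= C1 * (2 ^- K) ^+ 2) ->
  forall a : 'I_#|S|, let x := iter K (newton (@subsys _ _ g S)) 0 in
    0 <= x a 0 <= mu (enum_val a) 0 /\ mu (enum_val a) 0 - x a 0 <= C * 2 ^- K.
Proof.
(* The empty set is a component when n = 0. *)
move=> C10; have [S0|/set0Pn[i1 i1S]] := eqVneq S set0.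
  by exists 1 => // K g nu _ _ a; have := enum_valP a; rewrite {2}S0 inE.
have i0 : 'I_#|S| := enum_rank_in i1S i1.
have cF0 : nneg cF by move=> a j; rewrite mxE; exact: qeval_ge0.
have lF0 : nneg lF by move=> a b; rewrite mxE; exact: qjac_ge0.
have qS0 a b b' : 0 <= qS a b b' by exact: q0.
have qSC a b b' : qS a b b' = qS a b' b by exact: qC.
have m0 a : 0 < m a 0 by rewrite mxE.
have [C C0 err] := perturbed_newton_error i0 qS0 qSC cF0 lF0 m0 component_fix
  component_least component_irr.
(* With v the error in the deeper values and w the values used, the constant part changes by F'(w) v
   + B(v, v) <= A v, and the linear part by entries of 2 B(v). M dominates the row sums of both. *)
pose A := qjac l q mu + contract q mu.
have A0 : nneg A by apply: nnegD; [exact: qjac_ge0|exact: contract_ge0].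
pose B i k : R := \sum_j q i k j.
pose M := \sum_i (\sum_k A i k + \sum_k 2 * B i k).
have B0 i k : 0 <= B i k by apply: sumr_ge0 => j _.
have M0 i : 0 <= \sum_k A i k + \sum_k 2 * B i k.
  by rewrite addr_ge0 // sumr_ge0 // => k _; rewrite mulr_ge0.
have leM i : \sum_k A i k + \sum_k 2 * B i k <= M.
  by rewrite /M [leRHS](bigD1 i) //= lerDl sumr_ge0.
have Mge0 : 0 <= M := le_trans (M0 i1) (leM i1).
exists (C * (2 + M * C1)); first by rewrite mulr_gt0 // ltr_pwDl // mulr_ge0.
move=> K g nu gE nuP a x.
pose w := mask (deeper t) nu.
have w0 : nneg w by move=> k j; rewrite mxE; case: ifP => // /nuP[/andP[]].
pose v := wF - w.
have vE k : v k 0 = if k \in deeper t then mu k 0 - nu k 0 else 0.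
  by rewrite mxDE mxNE [wF _ _]mxE [w _ _]mxE; case: ifP => // _; rewrite subrr.
have v0 : nneg v.
  by move=> k j; rewrite ord1 vE; case: ifP => // /nuP[/andP[_ h] _]; rewrite subr_ge0.
have vmu : nneg (mu - v).
  move=> k j; rewrite ord1 mxDE mxNE vE; case: ifP => [/nuP[/andP[h _] _]|_].
    by rewrite opprB addrCA subrr addr0.
  by rewrite subr0.
have wmu : nneg (mu - w).
  move=> k j; rewrite ord1 mxDE mxNE [w _ _]mxE; case: ifP => [/nuP[/andP[_ h] _]|_].
    by rewrite subr_ge0.
  by rewrite subr0.
set dl := C1 * (2 ^- K) ^+ 2 in nuP.
have dl0 : 0 <= dl by rewrite mulr_ge0 // exprn_ge0 // invr_ge0 exprn_ge0.
have vdl k : v k 0 <= dl.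
  by rewrite vE; case: ifP => // /nuP[].
(* eta^2 has to dominate M C1 2^-(2K), and (1 + y)^2 >= y for y = M C1. Then eta + 2^-K = (2 + M C1)
   2^-K, which is the constant chosen above. *)
pose eta := (1 + M * C1) * 2 ^- K.
have eta0 : 0 <= eta.
  by rewrite mulr_ge0 ?invr_ge0 ?exprn_ge0 // addr_ge0 // mulr_ge0.
have Meta : dl * M <= eta ^+ 2.
  rewrite /eta /dl exprMn mulrAC ler_wpM2r ?exprn_ge0 ?invr_ge0 ?exprn_ge0 //.
  have : 0 <= M * C1 by rewrite mulr_ge0.
  by rewrite [C1 * M]mulrC; move: (M * C1) => y; nra.
have wFE : wF = w + v by rewrite /v subrKC.
have row_bound (D : 'M[R]_n) i : nneg D -> (D *m v) i 0 <= dl * \sum_k D i k.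
  move=> D0; rewrite mxE mulr_sumr; apply: ler_sum => k _.
  by rewrite mulrC ler_wpM2r.
have hcE i : (qeval c l q wF - qeval c l q w) i 0 =
    (qjac l q w *m v) i 0 + (contract q v *m v) i 0.
  by rewrite wFE qeval_taylor // !mxLE; ring.
have Cv0 := contract_ge0 q0 v0.
have hc : nneg (cF - restr_cst c l q S w).
  move=> b j; rewrite ord1 !mxLE ![restr_cst _ _ _ _ _ _ _]mxE -mxNE -mxDE hcE.
  by rewrite addr_ge0 // nnegM //; exact: qjac_ge0.
have hlE b b' : lF b b' - restr_lin l q S w b b' = 2 * contract q v (enum_val b) (enum_val b').
  by rewrite ![restr_lin _ _ _ _ _ _]mxE /qjac wFE contractD !mxLE; ring.
have hl : nneg (lF - restr_lin l q S w).
  by move=> b b'; rewrite !mxLE hlE mulr_ge0.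
have [||b|b b'|x0 xm xC] := err (restr_cst c l q S w) (restr_lin l q S w) eta K _ _ hc hl eta0.
- by move=> b j; rewrite mxE; exact: qeval_ge0.
- by move=> b b'; rewrite mxE; exact: qjac_ge0.
- apply: le_trans Meta; rewrite ![restr_cst _ _ _ _ _ _ _]mxE -mxNE -mxDE hcE.
  rewrite -mxDE -mulmxDl; set i := enum_val b.
  have AD : nneg (A - (qjac l q w + contract q v)).
    have h1 := @qjac_le _ _ q q0 l l w mu _ wmu.
    have h2 := contract_ge0 q0 vmu.
    move=> k j; rewrite contractD contractN in h2.
    have := h2 k j; have : 0 <= (qjac l q mu - qjac l q w) k j.
      by apply: h1 => k' j'; rewrite subrr mxE.
    by rewrite /A !mxLE; lra.
  have := nnegM AD v0 i 0; rewrite mulmxBl !mxLE subr_ge0 => /le_trans; apply.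
  apply: le_trans (row_bound A i A0) _; rewrite ler_wpM2l //.
  apply: le_trans (leM i); rewrite lerDl sumr_ge0 // => k _; exact: mulr_ge0.
- apply: le_trans Meta; rewrite hlE.
  set i := enum_val b; set k := enum_val b'.
  have : contract q v i k <= dl * B i k.
    rewrite mxE /B mulr_sumr; apply: ler_sum => j _.
    by rewrite mulrC ler_wpM2r.
  have : dl * (2 * B i k) <= dl * M.
    rewrite ler_wpM2l //; apply: le_trans (leM i).
    rewrite ler_wpDl ?sumr_ge0 // (bigD1 k) //= lerDl sumr_ge0 // => j _.
    exact: mulr_ge0.
  lra.
have xE : x = iter K (qnewton (restr_cst c l q S w) (restr_lin l q S w) qS) 0.
  by apply: eq_iter => Z; exact: newton_subsys.
have := xC a; have := xm a 0; have := x0 a 0; rewrite -xE => -> h1 h2; split.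
  by move: h1; rewrite mxLE mxNE subr_ge0 [m _ _]mxE.
move: h2; rewrite [m _ _]mxE => /le_trans; apply; rewrite /eta -mulrA ler_pM2l //.
by rewrite le_eqVlt; apply/orP; left; apply/eqP; ring.
Qed.

End OneComponent.
End ComponentStep.

(** * The decomposed Newton method *)

Section Decomposition.
Context {R : realType} {n : nat} (f : psys R n).
Context (c : 'cV[R]_n) (l : 'M[R]_n) (q : 'I_n -> 'I_n -> 'I_n -> R).
Hypothesis c0 : nneg c.
Hypothesis l0 : nneg l.
Hypothesis q0 : forall i k j, 0 <= q i k j.
Hypothesis qC : forall i k j, q i k j = q i j k.
Hypothesis fE : forall i, f i = qpoly (c i 0) (l i) (q i).
Context (mu : 'cV[R]_n).
Hypothesis muE : qeval c l q mu = mu.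
Hypothesis mu_least : forall z, nneg z -> nneg (z - qeval c l q z) -> nneg (z - mu).
Hypothesis mu_gt0 : forall i, 0 < mu i 0.

Lemma eq_fix_vars (P : {set 'I_n}) (nu nu' : 'cV[R]_n) i :
  (forall k, k \in P -> nu k 0 = nu' k 0) -> fix_vars f P nu i = fix_vars f P nu' i.
Proof.
move=> nuE; congr (_ \mPo _); apply: eq_from_tnth => k; rewrite !tnth_mktuple.
by case: ifP => // /nuE ->.
Qed.

Definition update (S : {set 'I_n}) (x : 'cV[R]_#|S|) (nu : 'cV[R]_n) : 'cV[R]_n :=
  \col_k (if k \in S then extend (fun a => x a 0) k else nu k 0).

Lemma subst_fix_vars (P S : {set 'I_n}) (g : psys R n) (x : 'cV[R]_#|S|) nu i :
    [disjoint P & S] -> g i = fix_vars f P nu i ->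
  subst g x i = fix_vars f (P :|: S) (update x nu) i.
Proof.
move=> PS gi; rewrite /subst gi /fix_vars fE comp_qpolyA; congr (_ \mPo _).
apply: eq_from_tnth => k; rewrite !tnth_mktuple inE [update _ _ _ _]mxE.
have [kP|kP] /= := boolP (k \in P); first by rewrite comp_mpolyC (disjointFr PS).
by rewrite comp_mpolyXU -tnth_nth tnth_mktuple; case: ifP.
Qed.

Definition accurate (P : {set 'I_n}) (nu : 'cV[R]_n) (d : R) :=
  forall k, k \in P -> 0 <= nu k 0 <= mu k 0 /\ mu k 0 - nu k 0 <= d.

Lemma accurate_update (P S : {set 'I_n}) (x : 'cV[R]_#|S|) nu d :
    accurate P nu d ->
    (forall a, 0 <= x a 0 <= mu (enum_val a) 0 /\ mu (enum_val a) 0 - x a 0 <= d) ->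
  accurate (P :|: S) (update x nu) d.
Proof.
move=> accP accS k; rewrite inE [update _ _ _ _]mxE.
have [kS _|kS] := boolP (k \in S); last by rewrite orbF; exact: accP.
by rewrite -(enum_rankK_in kS kS) extend_enum_val.
Qed.

Lemma accurate_disjoint (P S : {set 'I_n}) (x : 'cV[R]_#|S|) nu d :
  [disjoint P & S] -> accurate P nu d -> accurate P (update x nu) d.
Proof.
by move=> PS acc k kP; rewrite [update _ _ _ _]mxE (disjointFr PS kP); exact: acc.
Qed.

Section Level.
Context (j t : nat) (C C1 : R).
Let K := (j * 2 ^ t)%N.
Hypothesis step : forall S, S \in sccs f -> depth f S = t ->
  forall (g : psys R n) (nu : 'cV[R]_n),
    (forall i, i \in S -> g i = fix_vars f (deeper f t) nu i) ->
    accurate (deeper f t) nu (C1 * (2 ^- K) ^+ 2) ->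
  forall a : 'I_#|S|, let x := iter K (newton (@subsys _ _ g S)) 0 in
    0 <= x a 0 <= mu (enum_val a) 0 /\ mu (enum_val a) 0 - x a 0 <= C * 2 ^- K.

(* P is the set of variables whose values have been substituted so far. *)
Definition level_inv (P : {set 'I_n}) (st : psys R n * 'cV[R]_n) :=
  [/\ forall i, (vdepth f i < t)%N -> st.1 i = fix_vars f P st.2 i,
      forall i, vdepth f i = t -> st.1 i = fix_vars f (deeper f t) st.2 i,
      accurate (deeper f t) st.2 (C1 * (2 ^- K) ^+ 2) &
      accurate P st.2 (C * 2 ^- K)].

(** Components of equal depth do not influence each other: [dnm_scc] rewrites only equations of
    smaller depth, so those at depth t keep exactly the substitutions from [deeper f t], and storing
    new values on S leaves the deeper ones intact. *)
Lemma foldl_dnm_scc (L : seq {set 'I_n}) (P : {set 'I_n}) st :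
    uniq L -> (forall S, S \in L -> S \in sccs f /\ depth f S = t) ->
    (forall S, S \in L -> [disjoint P & S]) -> deeper f t \subset P ->
    level_inv P st ->
  level_inv (P :|: [set k | has (fun S : {set 'I_n} => k \in S) L])
    (foldl (dnm_scc f j t) st L).
Proof.
elim: L P st => [|S L IH] P [g nu] /=.
  move=> _ _ _ _; suff -> : [set k : 'I_n | false] = set0 by rewrite setU0.
  by apply/setP => k; rewrite !inE.
move=> /andP[SL uL] hL dL DP [inv1 inv2 accD accP].
have [hS St] := hL S (mem_head _ _).
have PS : [disjoint P & S] by apply: dL; exact: mem_head.
have DS : [disjoint deeper f t & S] by apply: disjointWl PS.
set x := iter _ _ _; rewrite -/(update x nu).
have -> : P :|: [set k | (k \in S) || has (fun T : {set 'I_n} => k \in T) L] =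
    (P :|: S) :|: [set k | has (fun T : {set 'I_n} => k \in T) L].
  by apply/setP => k; rewrite !inE orbA.
have updD i : fix_vars f (deeper f t) (update x nu) i = fix_vars f (deeper f t) nu i.
  by apply: eq_fix_vars => k kD; rewrite [update _ _ _ _]mxE (disjointFr DS).
apply: IH => // [T TL|T TL||].
- by apply: hL; rewrite inE TL orbT.
- rewrite disjoint_subset; apply/subsetP => k; rewrite !inE => /orP[kP|kS].
    by rewrite (disjointFr (dL T _) kP) ?inE ?TL ?orbT.
  apply/negP => kT; have hT := (hL T (mem_behead (s := S :: L) TL)).1.
  by rewrite (sccs_disjoint hS hT kS kT) TL in SL.
- exact: subset_trans DP (subsetUl _ _).
split=> [i it|i it||] /=.
- by rewrite exists_shallow_scc it; apply: subst_fix_vars => //; exact: inv1.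
- by rewrite exists_shallow_scc it ltnn updD; exact: inv2.
- exact: accurate_disjoint.
- apply: accurate_update => // a; apply: (step hS St _ accD) => i iS.
  by apply: inv2; rewrite -(vdepth_sccs hS iS).
Qed.

Lemma dnm_level_spec st : 0 <= C1 -> C1 <= C ->
    (forall i, (vdepth f i <= t)%N -> st.1 i = fix_vars f (deeper f t) st.2 i) ->
    accurate (deeper f t) st.2 (C1 * (2 ^- K) ^+ 2) ->
  let st' := dnm_level f j st t in
  let P := [set k | (t <= vdepth f k)%N] in
  (forall i, (vdepth f i < t)%N -> st'.1 i = fix_vars f P st'.2 i) /\
  accurate P st'.2 (C * 2 ^- K).
Proof.
move=> C10 C1C inv acc st' P.
(* The deeper values are known to the squared accuracy; weakening it gives one bound for all
   variables treated so far. *)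
have accC : accurate (deeper f t) st.2 (C * 2 ^- K).
  move=> k /acc[h1 h2]; split=> //; apply: (le_trans h2).
  have e0 : 0 <= 2 ^- K :> R by rewrite invr_ge0 exprn_ge0.
  have e1 : 2 ^- K <= 1 :> R by rewrite invf_le1 ?exprn_gt0 // exprn_ege1 // ler1n.
  by rewrite ler_pM // ?exprn_ge0 // expr2 ler_piMr.
have [|S|S|||inv1 _ _ accP] := @foldl_dnm_scc (enum (sccs_at f t)) (deeper f t) st.
- exact: enum_uniq.
- by rewrite mem_enum inE => /andP[hS /eqP].
- rewrite mem_enum inE => /andP[hS /eqP St].
  rewrite disjoint_subset; apply/subsetP => k; rewrite !inE => tk.
  by apply/negP => kS; move: tk; rewrite -(vdepth_sccs hS kS) St ltnn.
- exact: subxx.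
- by split=> // i it; apply: inv; [exact: ltnW|rewrite it].
suff -> : P = deeper f t :|: [set k | has (fun S : {set 'I_n} => k \in S) (enum (sccs_at f t))].
  by split.
apply/setP => k; rewrite !inE leq_eqVlt orbC; congr (_ || _).
apply/eqP/hasP => [tk|[S]].
  by exists (scc f k); [rewrite mem_enum inE scc_sccs /= tk|exact: mem_scc].
by rewrite mem_enum inE => /andP[hS /eqP <-] kS; rewrite (vdepth_sccs hS kS).
Qed.

End Level.

(** The state is a function of j so that C can be chosen before j, uniformly over the finitely many
    components. *)
Lemma dnm_level_error t (st : nat -> psys R n * 'cV[R]_n) (C1 : R) : 0 <= C1 ->
    (forall j i, (vdepth f i <= t)%N -> (st j).1 i = fix_vars f (deeper f t) (st j).2 i) ->
    (forall j, accurate (deeper f t) (st j).2 (C1 * (2 ^- (j * 2 ^ t)) ^+ 2)) ->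
  let P := [set k | (t <= vdepth f k)%N] in
  exists2 C, 0 < C & forall j, let st' := dnm_level f j (st j) t in
    (forall i, (vdepth f i < t)%N -> st'.1 i = fix_vars f P st'.2 i) /\
    accurate P st'.2 (C * 2 ^- (j * 2 ^ t)).
Proof.
move=> C10 inv acc P.
pose Q (S : {set 'I_n}) (C : R) := S \in sccs f -> depth f S = t ->
  forall (K : nat) (g : psys R n) (nu : 'cV[R]_n),
    (forall i, i \in S -> g i = fix_vars f (deeper f t) nu i) ->
    accurate (deeper f t) nu (C1 * (2 ^- K) ^+ 2) ->
  forall a : 'I_#|S|, let x := iter K (newton (@subsys _ _ g S)) 0 in
    0 <= x a 0 <= mu (enum_val a) 0 /\ mu (enum_val a) 0 - x a 0 <= C * 2 ^- K.
have [S|S C C' CC' h hS St K g nu gE accD a|C C0 hC] := @exists_uniform_bound R _ Q.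
- have [hS|hS] := boolP (S \in sccs f); last by exists 1 => // hS'; rewrite hS' in hS.
  have [St|St] := eqVneq (depth f S) t; last by exists 1 => // _ /eqP; rewrite (negPf St).
  have [C C0 h] := component_newton_error c0 l0 q0 qC fE muE mu_least mu_gt0 hS St C10.
  by exists C => // _ _; exact: h.
- have [h1 h2] := h hS St K g nu gE accD a; split=> //; apply: (le_trans h2).
  by rewrite ler_wpM2r // invr_ge0 exprn_ge0.
exists (C + C1) => [|j]; first by rewrite ltr_pwDl.
apply: (@dnm_level_spec j t (C + C1) C1) => [||||]; last exact: acc.
- move=> S hS St g nu gE accD a x.
  have [h1 h2] := hC S hS St (j * 2 ^ t)%N g nu gE accD a; split=> //.
  by apply: (le_trans h2); rewrite ler_wpM2r ?invr_ge0 ?exprn_ge0 // lerDl.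
- exact: C10.
- by rewrite lerDr ltW.
- exact: inv.
Qed.

Lemma dnm_levels_error t (st : nat -> psys R n * 'cV[R]_n) (C1 : R) : 0 <= C1 ->
    (forall j i, (vdepth f i <= t)%N -> (st j).1 i = fix_vars f (deeper f t) (st j).2 i) ->
    (forall j, accurate (deeper f t) (st j).2 (C1 * (2 ^- (j * 2 ^ t)) ^+ 2)) ->
  exists2 C, 0 < C & forall j,
    accurate [set: 'I_n] (foldl (dnm_level f j) (st j) (rev (iota 0 t.+1))).2 (C * 2 ^- j).
Proof.
elim: t st C1 => [|t IH] st C1 C10 inv acc;
  have [C C0 hC] := dnm_level_error C10 inv acc.
  exists C => // j; have -> : [set: 'I_n] = [set k | (0 <= vdepth f k)%N].
    by apply/setP => k; rewrite !inE.
  by have [_] := hC j; rewrite expn0 muln1.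
have deeperE : [set k | (t.+1 <= vdepth f k)%N] = deeper f t by [].
have [|j i it|j|D D0 hD] := IH (fun j => dnm_level f j (st j) t.+1) C.
- exact: ltW.
- by have [h _] := hC j; exact: h.
(* Since 2^-(j 2^(t+1)) is the square of 2^-(j 2^t), the accuracy reached at depth t+1 is exactly
   the one required at depth t. *)
- have [_] := hC j; rewrite deeperE expnS mulnCA [(2 * _)%N]mulnC exprM.
  by rewrite exprVn.
exists D => // j; have -> : rev (iota 0 t.+2) = t.+1 :: rev (iota 0 t.+1).
  by rewrite -[t.+2]addn1 iotaD rev_cat.
exact: hD.
Qed.

Lemma dnm_error : exists2 C, 0 < C & forall j k,
  0 <= dnm f j k 0 <= mu k 0 /\ mu k 0 - dnm f j k 0 <= C * 2 ^- j.
Proof.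
have D0 : deeper f (height f) = set0.
  by apply/setP => k; rewrite !inE ltnNge vdepth_height.
(* No variable is deeper than the height, so the induction starts with error constant 0 and an empty
   substitution. *)
have [|j i _|j k|C C0 hC] := @dnm_levels_error (height f) (fun=> (f, 0)) 0.
- by [].
- rewrite D0 /fix_vars -[LHS]comp_mpoly_id; congr (_ \mPo _).
  by apply: eq_from_tnth => k; rewrite !tnth_mktuple inE.
- by rewrite D0 inE.
by exists C => // j k; apply: hC; rewrite inE.
Qed.

End Decomposition.

Theorem theorem5p3 (R : realType) (n : nat) (f : psys R n)
    (f_monotone : monotone f) (f_quadratic : quadratic f)
    (f_clean : clean f) (f_feasible : feasible f) :
  exists k_f : nat, forall i : nat,
    valid_bits i (lfp f) (dnm f (k_f + i)).
Proof.
have /choice[c /choice[l /choice[q qf]]] i := quadratic_qpoly (f_quadratic i) (f_monotone i).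
pose cv : 'cV[R]_n := \col_i c i; pose lm : 'M[R]_n := \matrix_(i, k) l i k.
have c0 : nneg cv by move=> i j; rewrite mxE; have [] := qf i.
have l0 : nneg lm by move=> i k; rewrite mxE; have [_ h] := qf i.
have q0 i k j : 0 <= q i k j by have [_ _ h] := qf i.
have qC i k j : q i k j = q i j k by have [_ _ _ h] := qf i.
have fE i : f i = qpoly (cv i 0) (lm i) (q i).
  have [_ _ _ _ ->] := qf i; rewrite mxE; congr qpoly.
  by apply/funext => k; rewrite mxE.
have [mu0 muE mu_least] := lfp_least_prefixpoint c0 l0 q0 qC fE f_feasible.
have mu_gt0 := fixpoint_gt0 c0 l0 q0 qC fE muE mu0 f_clean.
have [C C0 hC] := dnm_error c0 l0 q0 qC fE muE mu_least mu_gt0.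
(* C <= D mu_k turns the absolute error into a relative one; D < [Num.bound D] < 2 ^ [Num.bound D]
   then absorbs D into the extra bits. *)
have [D D0 hD] := vec_bound (const_mx C) mu_gt0.
exists (Num.bound D) => i k.
have [/andP[_ h1] h2] := hC (Num.bound D + i)%N k.
rewrite (ger0_norm (mu0 _ _)) ger0_norm ?subr_ge0 // ler_pdivrMr //.
apply: (le_trans h2); rewrite exprD invfM mulrA [leRHS]mulrC ler_wpM2r //.
  by rewrite invr_ge0 exprn_ge0.
rewrite ler_pdivrMr ?exprn_gt0 // mulrC; have := hD k; rewrite mxE => /le_trans; apply.
rewrite ler_pM2r //; apply: ltW; apply: (lt_le_trans (archi_boundP (ltW D0))).
by rewrite -natrX ler_nat ltnW // ltn_expl.
Qed.
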